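(* For $n\ge1$ and $f\in C([-1,1]^2)$ let $\mathcal{L}_nf$ be the Lagrange interpolation polynomial of $f$ based on the Padua points $\mathrm{Pad}_n$. Let $0<p<\infty$. Then $$\lim_{n\to\infty}\|\mathcal{L}_nf-f\|_{W,p}=0\qquad\text{for all } f\in C([-1,1]^2).$$ In fact, let $E_n(f)_\infty$ be the error of the best approximation of $f$ by polynomials from $\Pi_n^2$ in the uniform norm on $[-1,1]^2$; then there is a constant $c_p$ depending only on $p$ (in particular independent of $n$ and $f$) such that, for all $n\ge 1$, $$\|\mathcal{L}_nf-f\|_{W,p}\le c_p\,E_n(f)_\infty\qquad\text{for all } f\in C([-1,1]^2).$$
   Context: $\Pi_n^2$ is the space of real polynomials in two variables of total degree at most $n$. $C([-1,1]^2)$ is the space of continuous functions on $[-1,1]^2$, and $E_n(f)_\infty=\inf_{P\in\Pi_n^2}\max_{\mathbf{x}\in[-1,1]^2}|f(\mathbf{x})-P(\mathbf{x})|$. $W$ is the Chebyshev weight $$W(x_1,x_2)=\frac{1}{\pi^2}\frac{1}{\sqrt{1-x_1^2}\sqrt{1-x_2^2}},\qquad -1<x_1,x_2<1,$$ and for $0<p<\infty$ $$\|f\|_{W,p}=\left(\int_{[-1,1]^2}|f(x_1,x_2)|^pW(x_1,x_2)\,dx_1\,dx_2\right)^{1/p}$$ (this notation is kept for $0<p<1$, although it is then not a norm). Padua points: for $n\ge1$, $$\mathrm{Pad}_n=\{\mathbf{x}_{k,j}=(\xi_k,\eta_j): 0\le k\le n,\ 1\le j\le \lfloor n/2\rfloor+1+\delta_k\},$$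 where $\xi_k=\cos\frac{k\pi}{n}$; $\eta_j=\cos\frac{(2j-1)\pi}{n+1}$ if $k$ is even and $\eta_j=\cos\frac{(2j-2)\pi}{n+1}$ if $k$ is odd (so $\eta_j$ depends also on the parity of $k$); and $\delta_k=1$ if $n$ and $k$ are both odd, $\delta_k=0$ otherwise. The set $\mathrm{Pad}_n$ is unisolvent for $\Pi_n^2$, and $\mathcal{L}_nf$ denotes the unique polynomial in $\Pi_n^2$ with $\mathcal{L}_nf(\mathbf{x})=f(\mathbf{x})$ for all $\mathbf{x}\in\mathrm{Pad}_n$. *)

(* Defs.v *)
From mathcomp Require Import all_boot all_order all_algebra.
(* The notations of mpoly clash with those of MathComp-Analysis. *)
From mathcomp Require Import -(notations) mpoly.
From mathcomp Require Import all_classical all_reals all_analysis.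
Import Order.TTheory GRing.Theory Num.Theory.
Import numFieldNormedType.Exports.

Set Implicit Arguments.
Unset Strict Implicit.
Unset Printing Implicit Defensive.

Local Open Scope classical_set_scope.
Local Open Scope ring_scope.

Section Padua.
Context {R : realType}.

Definition square : set (R * R) := `[-1, 1]%classic `*` `[-1, 1]%classic.

Definition poly2 := mpoly.mpoly 2 R.

(* msize is 1 + the total degree (and 0 for the zero polynomial). *)
Definition Pi2 (n : nat) : set poly2 := [set P | (mpoly.msize P <= n.+1)%N].

Definition eval2 (P : poly2) (x : R * R) : R :=
  mpoly.meval (fun i : 'I_2 => if i == ord0 then x.1 else x.2) P.

(* For f continuous on the square, the inner supremum is a maximum. *)
Definition best_error (n : nat) (f : R * R -> R) : R :=
  inf [set sup [set `|f x - eval2 P x| | x in square] | P in Pi2 n].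

(* On the boundary of the square, where the weight is undefined, x^-1 = 0 for
   x = 0 yields the value 0; the boundary is Lebesgue-negligible. *)
Definition cheb_weight (x : R * R) : R :=
  (pi ^+ 2)^-1 * (Num.sqrt (1 - x.1 ^+ 2))^-1 * (Num.sqrt (1 - x.2 ^+ 2))^-1.

Definition wnorm (p : R) (f : R * R -> R) : \bar R :=
  ((\int[lebesgue_measure \x lebesgue_measure]_(x in square)
      (`|f x| `^ p * cheb_weight x)%:E) `^ p^-1)%E.

Definition pad_xi (n k : nat) : R := cos (k%:R * pi / n%:R).

Definition pad_eta (n k j : nat) : R :=
  if odd k then cos ((2 * j%:R - 2) * pi / n.+1%:R)
  else cos ((2 * j%:R - 1) * pi / n.+1%:R).

Definition pad_delta (n k : nat) : nat := odd n && odd k.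

Definition Pad (n : nat) : set (R * R) :=
  [set x | exists k j : nat,
    [/\ (k <= n)%N, (1 <= j <= n./2 + 1 + pad_delta n k)%N
      & x = (pad_xi n k, pad_eta n k j)]].

Definition interpolates (n : nat) (f : R * R -> R) (P : poly2) : Prop :=
  Pi2 n P /\ forall x, Pad n x -> eval2 P x = f x.

(* Definite description: the unique interpolant, with default value 0 should
   existence or uniqueness fail (for n >= 1 neither does). *)
Definition padua_interp (n : nat) (f : R * R -> R) : poly2 :=
  xget 0 [set P | unique (interpolates n f) P].

End Padua.

Arguments poly2 : clear implicits.

(* Main.v *)
Require Import Defs.
From mathcomp Require Import all_boot all_order all_algebra.
From mathcomp Require Import complex.
From mathcomp Require Import -(notations) mpoly.
From mathcomp Require Import ring lra zify.
From mathcomp Require Import all_classical all_reals all_analysis measurable_realfun.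
Import Order.TTheory GRing.Theory Num.Theory.
Import numFieldNormedType.Exports.

Set Implicit Arguments.
Unset Strict Implicit.
Unset Printing Implicit Defensive.

Local Open Scope classical_set_scope.
Local Open Scope ring_scope.

(** Put [x = (cos t, cos u)].  A polynomial of degree at most [n] becomes a
    trigonometric sum on the torus with frequencies in the diamond
    [|k| + |l| <= n], the Chebyshev weight becomes the uniform measure, and the
    Padua points become the [2n(n+1)] nodes [(t pi/n, (t+1) pi/(n+1))], a coset of
    a finite subgroup of the torus ([padua_node]).  The diamond without the corner
    [(-n,0)] contains exactly one representative of each character of that
    subgroup ([diamond_alias]), so a sum with such frequencies is determined by
    its values at the nodes.  The corners [(n,0)] and [(-n,0)] agree on the nodes;
    replacing [cos (n t)] by [exp (i n t)], which has the same real part and the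
    same values at the nodes, moves every frequency into the reduced diamond
    ([trig_liftE], [lift_freq_diamond]).

    The heart of the matter is the inequality: a polynomial of degree at most [n]
    that is bounded by [E] on the Padua points has weighted [L^2m] norm at most
    [C_m E], for every [m] ([padua_sampling]).  Convolve the node values with a
    product of de la Vallee-Poussin kernels.  These have bounded discrete [L^1]
    norm, so the result [F] is bounded by a multiple of [E] everywhere
    ([quasi_le]); and the projection of [F] onto the reduced diamond is the lifted
    polynomial itself ([diamond_quasi]).  The reduced diamond is an intersection of five
    half-planes, and the projection onto a half-plane is bounded in [L^2m] by a
    form of the M. Riesz theorem ([riesz_halfplane]).  For even exponents the
    latter is elementary: if [A] is the projection of [f] and [B = f - A], all
    frequencies of [A^m conj(B)^m] are on one side of a line, so its mean is
    zero; expanding [B = f - A] bounds the mean of [|A|^2m] by mixed terms, which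
    are absorbed.  Means over the torus are taken over a fine square grid, which
    integrates trigonometric sums of bounded degree exactly; the Chebyshev measure
    of a polynomial is such a grid mean too ([grid_exact_Pi2]).

    The interpolation problem is injective by the same duality, and there are at
    least as many coefficients as points, so the interpolant exists and is unique
    ([padua_interpP]).  If [P] has degree at most [n] and uniform distance at most
    [E] from [f], then the interpolant [L] of [f] differs from [P] by a polynomial
    bounded by [E] on the Padua points.  The sampling inequality with [2m >= p]
    then bounds [|L - f|] in the weighted [L^p] quasi-norm by a multiple of [E]
    ([wnorm_padua_le]), which is the error estimate.  Convergence follows since the
    best error tends to zero by the Weierstrass theorem, proved here with
    bivariate Bernstein polynomials. *)

(** * The pointwise inequality behind the M. Riesz theorem *)

Section RieszPointwise.
Context {C : numClosedFieldType}.
Implicit Types (a b x z : C) (m : nat).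

(** The convex function [(1 + s)^(m+1)] lies below its secant on [0, 1], in the
    homogeneous form obtained from [s = b / a]. *)
Lemma exprD_le_secant a b m : 0 <= b -> b <= a ->
  (a + b) ^+ m.+1 <= a ^+ m.+1 + (2 ^+ m.+1 - 1) * b * a ^+ m.
Proof.
move=> b0 ba; have a0 : 0 <= a by apply: le_trans ba.
elim: m => [|m IH]; first by rewrite !expr1 expr0 (_ : 2 - 1 = 1) ?mul1r ?mulr1//; ring.
rewrite exprSr; apply: (le_trans (ler_wpM2r (addr_ge0 a0 b0) IH)).
have : 0 <= (2 ^+ m.+1 - 1) * b * a ^+ m * (a - b).
  rewrite mulr_ge0 ?subr_ge0// mulr_ge0 ?exprn_ge0// mulr_ge0// subr_ge0.
  by rewrite exprn_ege1// ler1n.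
set t := (X in 0 <= X) => t0; rewrite -subr_ge0.
by apply: le_trans t0 _; rewrite le_eqVlt; apply/orP; left; apply/eqP; rewrite /t !exprS; ring.
Qed.

(** With [K = 2^(m+2)], the factors [K] and [K + 1] bound [a] and [a + b] by
    multiples of [b] in the case [a <= K b]. *)
Definition riesz_const m : C := 2 * ((2 ^+ m.+2) * (2 ^+ m.+2 + 1)) ^+ m.

Lemma riesz_const_ge0 m : 0 <= riesz_const m.
Proof. by rewrite mulr_ge0// exprn_ge0// mulr_ge0 ?addr_ge0 ?exprn_ge0. Qed.

(** Absorption of the mixed terms: either [b] is so small compared with [a] that
    the increment of the [m]-th power is at most half of [a ^+ m], or [a] is
    bounded by a multiple of [b]. *)
Lemma riesz_pointwise a b m : 0 <= a -> 0 <= b ->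
  2 * (a ^+ m * ((a + b) ^+ m - a ^+ m))
    <= a ^+ (m + m) + riesz_const m * b ^+ (m + m).
Proof.
move=> a0 b0; case: m => [|m].
  by rewrite !expr0 subrr !mulr0 addr_ge0// mulr1 riesz_const_ge0.
set K : C := 2 ^+ m.+3; have K0 : 0 < K by rewrite exprn_gt0.
have K1 : 1 <= K by rewrite exprn_ege1// ler1n.
have [Kb|aK] : K * b <= a \/ a <= K * b.
  have := real_leVge (ger0_real (mulr_ge0 (ltW K0) b0)) (ger0_real a0).
  by case/orP; [left|right].
- have ba : b <= a by apply: le_trans Kb; rewrite ler_peMl.
  have h := exprD_le_secant m b0 ba.
  apply: (@le_trans _ _ (a ^+ (m.+1 + m.+1))); last first.
    by rewrite lerDl mulr_ge0 ?riesz_const_ge0 ?exprn_ge0.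
  rewrite mulrCA exprD ler_wpM2l ?exprn_ge0//.
  apply: (@le_trans _ _ (2 * ((2 ^+ m.+1 - 1) * b * a ^+ m))).
    by rewrite ler_pM2l// lerBlDl.
  rewrite [a ^+ m.+1]exprS !mulrA ler_wpM2r ?exprn_ge0//; apply: le_trans Kb.
  rewrite ler_wpM2r// /K [leRHS]exprS; apply: ler_wpM2l => //.
  rewrite lerBlDr (le_trans (_ : _ <= 2 ^+ m.+2)) ?lerDl//.
  by rewrite [leRHS]exprS ler_peMl ?exprn_ge0// ler1n.
- apply: (@le_trans _ _ (riesz_const m.+1 * b ^+ (m.+1 + m.+1))); last first.
    by rewrite lerDr exprn_ge0.
  rewrite /riesz_const -/K -mulrA ler_pM2l// exprD exprMn.
  rewrite (_ : _ * _ * _ = (K * b) ^+ m.+1 * ((K + 1) * b) ^+ m.+1); last first.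
    by rewrite !exprMn; ring.
  apply: ler_pM; rewrite ?exprn_ge0//.
  + by rewrite subr_ge0 lerXn2r ?nnegrE ?addr_ge0// lerDl.
  + by rewrite lerXn2r// nnegrE mulr_ge0// ltW.
  + rewrite (le_trans (_ : _ <= (a + b) ^+ m.+1)) ?lerBlDr ?lerDl ?exprn_ge0//.
    by rewrite lerXn2r ?nnegrE ?addr_ge0 ?mulr_ge0 ?addr_ge0 ?(ltW K0)// mulrDl mul1r lerD2r.
Qed.

Lemma norm_subXX_le x z m :
  `|x ^+ m - (x - z) ^+ m| <= (`|x| + `|z|) ^+ m - `|x| ^+ m.
Proof.
elim: m => [|m IH]; first by rewrite !expr0 !subrr normr0.
have -> : x ^+ m.+1 - (x - z) ^+ m.+1
    = x * (x ^+ m - (x - z) ^+ m) + z * (x - z) ^+ m by rewrite !exprS; ring.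
apply: (le_trans (ler_normD _ _)); rewrite !normrM !normrX.
have -> : (`|x| + `|z|) ^+ m.+1 - `|x| ^+ m.+1 =
   `|x| * ((`|x| + `|z|) ^+ m - `|x| ^+ m) + `|z| * (`|x| + `|z|) ^+ m.
  by rewrite !exprS; ring.
rewrite lerD// ler_wpM2l//; apply: lerXn2r; rewrite ?nnegrE ?addr_ge0//.
by apply: (le_trans (ler_normB _ _)).
Qed.

(** By the orthogonality hypothesis, the sum of [|A|^2m] equals the sum of
    [A^m (conj(A)^m - (conj(A) - conj(A + B))^m)], in which the pure power of [A]
    has disappeared; every remaining term carries a factor [A + B]. *)
Lemma riesz_sum (X : finType) (A B : X -> C) m :
  \sum_x A x ^+ m * Num.conj (B x) ^+ m = 0 ->
  \sum_x `|A x| ^+ (m + m) <= riesz_const m * \sum_x `|A x + B x| ^+ (m + m).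
Proof.
move=> AB0.
suff : 2 * \sum_x `|A x| ^+ (m + m) <= \sum_x `|A x| ^+ (m + m)
     + riesz_const m * \sum_x `|A x + B x| ^+ (m + m).
  by rewrite -lerBlDl -{2}[\sum__ _]mul1r -mulrBl (_ : 2 - 1 = 1) ?mul1r//; ring.
have S0 : 0 <= \sum_x `|A x| ^+ (m + m) by apply: sumr_ge0 => x _; rewrite exprn_ge0.
have SE : \sum_x `|A x| ^+ (m + m) = \sum_x A x ^+ m *
    (Num.conj (A x) ^+ m - (Num.conj (A x) - Num.conj (A x + B x)) ^+ m).
  have z0 : \sum_x (-1) ^+ m * (A x ^+ m * Num.conj (B x) ^+ m) = 0.
    by rewrite -mulr_sumr AB0 mulr0.
  rewrite -[LHS]subr0 -[X in _ - X]z0 -sumrB.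
  apply: eq_bigr => x _; rewrite rmorphD opprD addrA subrr sub0r.
  rewrite [in RHS]exprNn addnn -mul2n exprM normCK exprMn.
  set u := Num.conj (A x) ^+ m; set v := Num.conj (B x) ^+ m; ring.
rewrite -[X in 2 * X](ger0_norm S0) [X in `|X|]SE mulr_sumr -big_split/=.
apply: (le_trans (ler_wpM2l _ (ler_norm_sum _ _ _))) => //.
rewrite mulr_sumr; apply: ler_sum => x _.
apply: le_trans (riesz_pointwise m (normr_ge0 (A x)) (normr_ge0 (A x + B x))).
rewrite ler_pM2l// normrM normrX ler_wpM2l ?exprn_ge0//.
rewrite -(norm_conjC (A x)) -(norm_conjC (A x + B x)).
exact: norm_subXX_le.
Qed.

End RieszPointwise.

(** * Character sums on cyclic groups *)

Section Cis.
Context {R : realType}.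
Implicit Types (s t : R) (j : int).

Definition cis t : R[i] := Complex (cos t) (sin t).

Lemma cisD s t : cis (s + t) = cis s * cis t.
Proof.
rewrite /cis cosD sinD; apply/eqP; rewrite eq_complex /=.
by apply/andP; split; apply/eqP; ring.
Qed.

Lemma cis0 : cis 0 = 1.
Proof. by rewrite /cis cos0 sin0. Qed.

Lemma conj_cis t : Num.conj (cis t) = cis (- t).
Proof. by rewrite /cis cosN sinN. Qed.

Lemma norm_cis t : `|cis t| = 1.
Proof. by rewrite normc_def /= cos2Dsin2 sqrtr1. Qed.

Lemma cisMn t n : cis (t *+ n) = cis t ^+ n.
Proof. by elim: n => [|n IH]; rewrite ?cis0// mulrS cisD IH exprS. Qed.

Lemma cisMnat t n : cis (n%:R * t) = cis t ^+ n.
Proof. by rewrite mulr_natl cisMn. Qed.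

Lemma cisMz t j : cis (j%:~R * t) = cis t ^ j.
Proof.
case: j => n; first by rewrite -pmulrn cisMnat.
rewrite NegzE mulrNz mulNr -pmulrn -exprnN -cisMnat.
have h : cis (n.+1%:R * t) * cis (- (n.+1%:R * t)) = 1.
  by rewrite -cisD subrr cis0.
by rewrite (mulr1_eq h).
Qed.

Lemma cis2pi : cis (2 * pi) = 1.
Proof. by rewrite mulr_natl /cis cos2pi sin2pi. Qed.

(** From [1 - cos t = 2 sin(t/2)^2] and [0 < t/2 < pi]. *)
Lemma cis_eq1 t : 0 < t < 2 * pi -> cis t != 1.
Proof.
move=> /andP[t0 t2]; rewrite /cis eq_complex negb_and; apply/orP; left => /=.
have -> : t = (t / 2) *+ 2 by rewrite -mulr_natr mulfVK// pnatr_eq0.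
have s0 : 0 < sin (t / 2).
  apply: sin_gt0_pi; rewrite divr_gt0// /=.
  by rewrite ltr_pdivrMr// mulrC.
rewrite cos_mulr2n cos2sin2; apply/eqP => h.
have : sin (t/2) ^+ 2 > 0 by rewrite exprn_gt0.
move: h; set z := sin _ ^+ 2; rewrite -mulr_natr => h; lra.
Qed.

Lemma sum_cis (N : nat) j : (0 < N)%N ->
  \sum_(a < N) cis (j%:~R * (a%:R * (2 * pi / N%:R)))
    = (if (N %| j)%Z then N%:R else 0).
Proof.
move=> N0; have N0R : N%:R != 0 :> R by rewrite pnatr_eq0 -lt0n.
pose r := `|(j %% N)%Z|%N.
have rE : (j %% N)%Z = r by rewrite /r gez0_abs// modz_ge0// -lt0n.
have rN : (r < N)%N by rewrite -ltz_nat -rE ltz_pmod.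
pose z := cis (r%:R * (2 * pi / N%:R)).
have zN : z ^+ N = 1.
  rewrite -cisMnat [X in cis X](_ : _ = r%:R * (2 * pi)); last by field.
  by rewrite cisMnat cis2pi expr1n.
transitivity (\sum_(a < N) z ^+ a).
  apply: eq_bigr => a _.
  rewrite {1}(divz_eq j N) rE -cisMnat intrD intrM mulrDl cisD.
  rewrite -(mulrA _ (Posz N)%:~R) [X in cis X * _](_ : _ = (((j %/ N)%Z * a)%:~R * (2 * pi))); last first.
    by rewrite intrM -!pmulrn; field.
  rewrite cisMz cis2pi exp1rz mul1r; congr cis; rewrite -!pmulrn; ring.
have dE : (N %| j)%Z = (r == 0)%N by rewrite -(eqz_nat r 0) -rE; by apply/dvdz_mod0P/eqP.
case: ifPn; rewrite dE.
  move/eqP=> r0; rewrite /z r0 mul0r cis0.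
  by rewrite (eq_bigr (fun=> 1)) ?sumr_const ?card_ord// => a _; rewrite expr1n.
move=> r0; have z1 : z != 1.
  apply: cis_eq1; have rp : 0 < r%:R :> R by rewrite ltr0n lt0n.
  have pi2 : 0 < 2 * pi :> R by rewrite mulr_gt0// pi_gt0.
  have NR : 0 < N%:R :> R by rewrite ltr0n.
  rewrite mulr_gt0//= ?divr_gt0// mulrA ltr_pdivrMr// mulrC ltr_pM2l//.
  by rewrite ltr_nat.
have := subrX1 z N; rewrite zN subrr => /esym/eqP; rewrite mulf_eq0 subr_eq0 (negPf z1) /=.
by move/eqP.
Qed.

End Cis.

(** * Half-plane projections of trigonometric sums *)

Definition freq := (int * int)%type.

Definition slope (u al : freq) : int := u.1 * al.1 + u.2 * al.2.

Section Trig.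
Context {R : realType}.
Local Notation C := R[i].
Implicit Types (x : R * R) (u al be : freq) (a : int).

Definition chi al x : C := cis (al.1%:~R * x.1 + al.2%:~R * x.2).

Definition freqD al be : freq := (al.1 + be.1, al.2 + be.2).
Definition freqN al : freq := (- al.1, - al.2).

Lemma chiD al be x : chi (freqD al be) x = chi al x * chi be x.
Proof. by rewrite /chi -cisD /= !intrD; congr cis; ring. Qed.

Lemma conj_chi al x : Num.conj (chi al x) = chi (freqN al) x.
Proof. by rewrite /chi conj_cis /= !intrN; congr cis; ring. Qed.

Definition gridpt (M : nat) (a : 'I_M * 'I_M) : R * R :=
  (a.1%:R * (2 * pi / M%:R), a.2%:R * (2 * pi / M%:R)).

Lemma sum_grid_chi M al : (0 < M)%N ->
  \sum_(a : 'I_M * 'I_M) chi al (gridpt a)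
   = if (M %| al.1)%Z && (M %| al.2)%Z then (M * M)%:R else 0.
Proof.
move=> M0.
transitivity ((\sum_(a < M) cis (al.1%:~R * (a%:R * (2 * pi / M%:R)))) *
   (\sum_(b < M) cis (al.2%:~R * (b%:R * (2 * pi / M%:R)))) : C).
  rewrite big_distrlr pair_bigA /=; apply: eq_bigr => -[a b] _ /=.
  by rewrite /chi cisD.
rewrite !sum_cis//; case: ifP => _; last by rewrite mul0r.
by case: ifP => _; rewrite ?mulr0// natrM.
Qed.

(** The predicate [P] selects the frequencies that are kept, so that a spectral
    projection is a change of predicate. *)
Definition trig_sum (I : finType) (c : I -> C) (al : I -> freq) (P : pred I) x :=
  \sum_(i | P i) c i * chi (al i) x.

(** A function given by a finite trigonometric sum whose frequencies lie in the
    half-plane [a <= slope u] and in the square of half-side [K].  The bound [K]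
    is what makes a fine grid see nonzero frequencies as nonzero. *)
Definition has_spectrum u a (K : nat) (g : R * R -> C) := exists s : seq (C * freq),
  (forall x, g x = \sum_(c <- s) c.1 * chi c.2 x) /\
  all (fun c => [&& a <= slope u c.2, `|c.2.1| <= K%:Z & `|c.2.2| <= K%:Z]) s.

Lemma has_spectrum1 u : has_spectrum u 0 0 (fun=> 1).
Proof.
exists [:: (1, (0, 0))]; split=> [x|] /=.
  by rewrite big_seq1 /chi/= !mul0r addr0 cis0 mulr1.
by rewrite /slope/= !mulr0 addr0.
Qed.

Lemma has_spectrum_mul u a a' K K' g g' : has_spectrum u a K g -> has_spectrum u a' K' g' ->
  has_spectrum u (a + a') (K + K') (fun x => g x * g' x).
Proof.
move=> [s [gE sP]] [s' [g'E s'P]].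
exists [seq (c.1 * c'.1, freqD c.2 c'.2) | c <- s, c' <- s']; split=> [x|].
  rewrite gE g'E big_allpairs_dep big_distrl /=; apply: eq_bigr => c _.
  by rewrite big_distrr /=; apply: eq_bigr => c' _; rewrite chiD mulrACA.
apply/allP => _ /allpairsP[[c c'] [/= cs cs' ->]] /=.
move: (allP sP _ cs) (allP s'P _ cs') => /and3P[h1 h2 h3] /and3P[k1 k2 k3].
rewrite PoszD; apply/and3P; split.
- by move: h1 k1; rewrite /slope /=; lia.
- exact: le_trans (ler_normD _ _) (lerD h2 k2).
- exact: le_trans (ler_normD _ _) (lerD h3 k3).
Qed.

Lemma has_spectrum_exp u a K g m : has_spectrum u a K g ->
  has_spectrum u (a *+ m) (K * m) (fun x => g x ^+ m).
Proof.
move=> sg; elim: m => [|m IH].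
  by rewrite mulr0n muln0; have := has_spectrum1 u; congr has_spectrum; apply/funext => x.
rewrite mulrS mulnS; have := has_spectrum_mul sg IH; congr has_spectrum; apply/funext => x.
by rewrite exprS.
Qed.

Lemma has_spectrum_trig (I : finType) (c : I -> C) (fr : I -> freq) (P : pred I) u a K :
  (forall i, P i -> a <= slope u (fr i)) ->
  (forall i, `|(fr i).1| <= K%:Z) -> (forall i, `|(fr i).2| <= K%:Z) ->
  has_spectrum u a K (trig_sum c fr P).
Proof.
move=> Pa K1 K2; exists [seq (c i, fr i) | i <- enum I & P i]; split=> [x|].
  by rewrite big_map big_filter big_enum_cond/= /trig_sum.
apply/allP => _ /mapP[i + ->] /=; rewrite mem_filter => /andP[Pi _].
by rewrite Pa// K1 K2.
Qed.

Lemma conj_trig_sum (I : finType) (c : I -> C) (fr : I -> freq) (P : pred I) x :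
  Num.conj (trig_sum c fr P x) = trig_sum (fun i => Num.conj (c i)) (fun i => freqN (fr i)) P x.
Proof.
by rewrite rmorph_sum; apply: eq_bigr => i _; rewrite rmorphM /= conj_chi.
Qed.

Lemma has_spectrum_sum0 u a K g M : has_spectrum u a K g -> 0 < a -> (K < M)%N ->
  \sum_(b : 'I_M * 'I_M) g (gridpt b) = 0.
Proof.
move=> [s [gE /allP sP]] a0 KM; have M0 : (0 < M)%N by apply: leq_ltn_trans KM.
under eq_bigr do rewrite gE.
rewrite exchange_big big1_seq//= => c cs.
rewrite -mulr_sumr sum_grid_chi//; case: ifP => [/andP[d1 d2]|]; last by rewrite mulr0.
have /and3P[h1 h2 h3] := sP _ cs.
have z (j : int) : (M %| j)%Z -> `|j| <= K%:Z -> j = 0.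
  move=> /dvdzP[q ->]; rewrite normrM => h.
  have [->|q0] := eqVneq q 0; first by rewrite mul0r.
  have : 1 <= `|q| by rewrite -gtz0_ge1 normr_gt0.
  move: h KM; rewrite (_ : `|Posz M| = M)//; nia.
by move: h1; rewrite /slope (z _ d1 h2) (z _ d2 h3) !mulr0 addr0 => /(lt_le_trans a0); rewrite ltxx.
Qed.

(** The part [A] kept has slopes at least [s + 1], the conjugate of the rest [B]
    has slopes at least [- s]; hence [A^m conj(B)^m] has slopes at least [m] and
    mean zero on a fine grid. *)
Lemma riesz_halfplane (I : finType) (c : I -> C) (fr : I -> freq) (P : pred I) u s K M m :
  (0 < m)%N -> (K * m + K * m < M)%N ->
  (forall i, `|(fr i).1| <= K%:Z) -> (forall i, `|(fr i).2| <= K%:Z) ->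
  \sum_(b : 'I_M * 'I_M)
     `|trig_sum c fr [pred i | P i && (s < slope u (fr i))] (gridpt b)| ^+ (m + m)
  <= riesz_const m * \sum_(b : 'I_M * 'I_M) `|trig_sum c fr P (gridpt b)| ^+ (m + m).
Proof.
move=> m0 KM K1 K2.
pose A := trig_sum c fr [pred i | P i && (s < slope u (fr i))].
pose B := trig_sum c fr [pred i | P i && ~~ (s < slope u (fr i))].
have AB x : trig_sum c fr P x = A x + B x.
  by rewrite /trig_sum (bigID (fun i => s < slope u (fr i)))/=.
under [X in _ <= _ * X]eq_bigr do rewrite AB.
apply: riesz_sum => /=.
have sA : has_spectrum u (s + 1) K A.
  by apply: has_spectrum_trig => // i /= /andP[_]; rewrite lezD1.
have sB : has_spectrum u (- s) K (fun x => Num.conj (B x)).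
  have := @has_spectrum_trig I (fun i => Num.conj (c i)) (fun i => freqN (fr i))
      [pred i | P i && ~~ (s < slope u (fr i))] u (- s) K.
  rewrite -[trig_sum _ _ _](_ : (fun x => Num.conj (B x)) = _); last first.
    by apply/funext => x; exact: conj_trig_sum.
  apply=> [i /= /andP[_]||] //=.
  - by rewrite -leNgt /slope /=; lia.
  - by move=> i; rewrite normrN.
  - by move=> i; rewrite normrN.
apply: (has_spectrum_sum0 (has_spectrum_mul (has_spectrum_exp m sA) (has_spectrum_exp m sB)) _ KM).
by rewrite -mulrnDl addrAC subrr add0r ltr0n.
Qed.

End Trig.

(** * A de la Vallee-Poussin kernel *)

Section Kernel.
Context {R : realType}.
Local Notation C := R[i].
Implicit Types (x : R * R) (t : R) (n : nat).

Definition dirichlet (L : nat) t : C := \sum_(j < L) cis (j%:R * t).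

(** Parseval on a grid of [K] points: since [L <= K], distinct frequencies of
    the sum stay distinct on the grid. *)
Lemma sum_dirichlet_sqr (L K : nat) t : (0 < K)%N -> (L <= K)%N ->
  \sum_(a < K) `|dirichlet L (t - a%:R * (2 * pi / K%:R))| ^+ 2 = (K * L)%:R.
Proof.
move=> K0 LK.
transitivity (\sum_(a < K) \sum_(j < L) \sum_(k < L)
    cis ((j%:Z - k%:Z)%:~R * t) *
    cis ((k%:Z - j%:Z)%:~R * (a%:R * (2 * pi / K%:R))) : C).
  apply: eq_bigr => a _; rewrite normCK /dirichlet rmorph_sum big_distrlr /=.
  apply: eq_bigr => j _; apply: eq_bigr => k _.
  by rewrite conj_cis -!cisD !intrB -!pmulrn; congr cis; ring.
rewrite exchange_big /=.
transitivity (\sum_(j < L) K%:R : C); last first.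
  by rewrite sumr_const card_ord -[LHS]mulr_natr natrM.
apply: eq_bigr => j _; rewrite exchange_big /= (bigD1 j)//=.
rewrite [X in _ + X]big1 ?addr0 => [|k kj].
  by rewrite -mulr_sumr subrr sum_cis// dvdz0 mul0r cis0 mul1r.
rewrite -mulr_sumr sum_cis//; case: ifP => [/dvdzP[q qE]|]; last by rewrite mulr0.
exfalso; move: kj; rewrite -val_eqE /=; move: (ltn_ord j) (ltn_ord k) => jL kL.
move: qE; have [->|q0] := eqVneq q 0; first by lia.
have : 1 <= `|q| by rewrite -gtz0_ge1 normr_gt0.
nia.
Qed.

Definition vdp_idx n : finType := ('I_n * 'I_(2 * n + n))%type.

Definition vdp_freq n (i : vdp_idx n) : int := i.2%:Z - n%:Z - i.1%:Z.

(** A Dirichlet sum of [3n] consecutive frequencies convolved, on the frequency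
    side, with [n] consecutive frequencies: the trapezoid equal to 1 on [-n, n],
    written with repetition of frequencies instead of weights. *)
Definition vdp n t : C := n%:R^-1 * \sum_(i : vdp_idx n) cis ((vdp_freq i)%:~R * t).

Lemma vdp_freq_bound n (i : vdp_idx n) : `|vdp_freq i| <= (2 * n)%N%:Z.
Proof. by case: i => i j; have := ltn_ord i; have := ltn_ord j; rewrite /vdp_freq /=; lia. Qed.

(** For [|k| <= n], each of the [n] shifts [j] completes to exactly one pair
    [(j, q)] of frequency [k]; this is the flat top of the trapezoid. *)
Lemma vdp_freq_count n (k : int) : `|k| <= n%:Z ->
  \sum_(i : vdp_idx n | vdp_freq i == k) 1 = n%:R :> C.
Proof.
move=> kn; rewrite big_mkcond.
transitivity (\sum_(j < n) \sum_(q < 2 * n + n)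
    if q%:Z - n%:Z - j%:Z == k then 1 else 0 : C).
  by rewrite pair_bigA; apply: eq_bigr => -[j q].
transitivity (\sum_(j < n) 1 : C); last by rewrite sumr_const card_ord.
apply: eq_bigr => j _.
have qL : (absz (k + n%:Z + j%:Z)%R < 2 * n + n)%N by have := ltn_ord j; lia.
rewrite (bigD1 (Ordinal qL))//= big1 ?addr0 => [|q]; first by rewrite ifT//; lia.
by rewrite -val_eqE /= => h; rewrite ifF//; lia.
Qed.

(** The kernel is, up to a unit factor, [conj(X) (Y + e X) / n] with [X], [Y]
    Dirichlet sums of lengths [n] and [2n] and [|e| = 1].  The point of splitting
    the long sum is that neither length exceeds the number [2n] of grid points, so
    that Parseval applies to both. *)
Lemma vdp_le n t : (0 < n)%N -> 2 * n%:R * `|vdp n t| <=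
  `|dirichlet (2 * n) t| ^+ 2 + 3 * `|dirichlet n t| ^+ 2.
Proof.
move=> n0; have n0C : n%:R != 0 :> C by rewrite pnatr_eq0 -lt0n.
have E : \sum_(i : vdp_idx n) cis ((vdp_freq i)%:~R * t) = Num.conj (dirichlet n t) *
   cis (- (n%:R * t)) * (dirichlet (2 * n) t + cis ((2 * n)%:R * t) * dirichlet n t).
  transitivity (\sum_(j < n) \sum_(q < 2 * n + n) cis (- (j%:R * t)) * cis (- (n%:R * t)) * cis (q%:R * t) : C).
    rewrite pair_bigA; apply: eq_bigr => -[j q] _ /=.
    by rewrite -!cisD /vdp_freq/= !intrB -!pmulrn; congr cis; ring.
  rewrite -(big_distrlr _ _) /=; congr (_ * _).
    by rewrite -mulr_suml rmorph_sum; congr (_ * _); apply: eq_bigr => j _; exact/esym/conj_cis.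
  rewrite big_split_ord/=; congr (_ + _); rewrite mulr_sumr.
  by apply: eq_bigr => j _; rewrite -cisD natrD mulrDl.
rewrite /vdp E !normrM norm_cis mulr1 norm_conjC normfV normr_nat.
set X := `|dirichlet n t|; set Y := dirichlet (2 * n) t.
have X0 : 0 <= X by exact: normr_ge0.
rewrite -mulrA mulVKf//; apply: (@le_trans _ _ (2 * (X * (`|Y| + X)))).
  rewrite ler_pM2l// ler_wpM2l//; apply: le_trans (ler_normD _ _) _.
  by rewrite normrM norm_cis mul1r.
rewrite -subr_ge0 (_ : _ - _ = (`|Y| - X) ^+ 2); last by ring.
by rewrite -real_normK ?rpredB ?normr_real// exprn_ge0.
Qed.

Lemma sum_vdp n t : (0 < n)%N ->
  \sum_(a < 2 * n) `|vdp n (t - a%:R * (pi / n%:R))| <= (5 * n)%:R.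
Proof.
move=> n0; have n0C : 0 < n%:R :> C by rewrite ltr0n.
rewrite -(@ler_pM2l _ (2 * n%:R)) ?mulr_gt0// mulr_sumr.
apply: (le_trans (ler_sum _ (fun a _ => vdp_le _ n0))).
rewrite big_split -mulr_sumr/=.
have pE : pi / n%:R = 2 * pi / (2 * n)%:R :> R.
  by rewrite natrM; field; rewrite pnatr_eq0 -lt0n.
under eq_bigr do rewrite pE.
under [X in _ + _ * X]eq_bigr do rewrite pE.
rewrite !sum_dirichlet_sqr ?muln_gt0//; last by lia.
by rewrite -!(natrM, natrD) ler_nat; nia.
Qed.

Lemma vdp_periodic n t q : vdp n (t - q%:R * (2 * pi)) = vdp n t.
Proof.
rewrite /vdp; congr (_ * _); apply: eq_bigr => i _.
rewrite mulrBr cisD -mulrN -[RHS]mulr1; congr (_ * _).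
have -> : (vdp_freq i)%:~R * - (q%:R * (2 * pi)) = (- (vdp_freq i * q))%:~R * (2 * pi) :> R.
  by rewrite intrN intrM -pmulrn; ring.
by rewrite cisMz cis2pi exp1rz.
Qed.

End Kernel.

(** By the Chinese remainder theorem for the moduli [2n] and [2(n+1)], whose
    least common multiple is [2n(n+1)], the pairs of residues of [t] and [t + 1]
    are distinct, so the sum over the nodes is part of the sum over the full
    product grid. *)
Lemma sum_crt_le (C : numDomainType) n (h1 h2 : nat -> C) : (0 < n)%N ->
  (forall a, 0 <= h1 a) -> (forall a, 0 <= h2 a) ->
  (forall a, h1 a = h1 (a %% (2 * n))%N) ->
  (forall a, h2 a = h2 (a %% (2 * n.+1))%N) ->
  \sum_(t < 2 * n * n.+1) h1 t * h2 t.+1 <=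
    (\sum_(a < 2 * n) h1 a) * (\sum_(b < 2 * n.+1) h2 b).
Proof.
move=> n0 h10 h20 p1 p2; rewrite big_distrlr pair_bigA /=.
have m1 t : (t %% (2 * n) < 2 * n)%N by rewrite ltn_mod muln_gt0.
have m2 t : (t %% (2 * n.+1) < 2 * n.+1)%N by rewrite ltn_mod.
pose f (t : 'I_(2 * n * n.+1)) := (Ordinal (m1 t), Ordinal (m2 t.+1)).
have fI : injective f.
  move=> s t [/eqP e1 /eqP e2]; apply/val_inj => /=.
  wlog st : s t e1 e2 / (s <= t)%N.
    move=> W; case/orP: (leq_total s t) => [/W|/W]; first exact.
    by move=> /(_ _ _)/esym; apply; rewrite eq_sym.
  move: e1; rewrite eq_sym eqn_mod_dvd// => /dvdnP[q1 E1].
  move: e2; rewrite eq_sym eqn_mod_dvd// subSS => /dvdnP[q2 E2].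
  have : (2 * n * n.+1 %| t - s)%N.
    have : (n * n.+1 %| q1 * n)%N.
      rewrite Gauss_dvd ?coprimenS// (dvdn_mull _ (dvdnn n)) /=.
      by apply/dvdnP; exists q2; nia.
    by move=> /dvdnP[q E]; apply/dvdnP; exists q; nia.
  move=> /dvdnP[q]; have := ltn_ord t; case: q => [|q]; nia.
rewrite (eq_bigr (fun t => h1 (f t).1 * h2 (f t).2)) => [|t _]; last by rewrite /f/= -p1 -p2.
rewrite -(big_imset (fun y : 'I_(2 * n) * 'I_(2 * n.+1) => h1 y.1 * h2 y.2))/=; last by move=> x y _ _; exact: fI.
rewrite [leRHS](bigID (mem (f @: 'I_(2 * n * n.+1))))/= lerDl.
by apply: sumr_ge0 => y _; rewrite mulr_ge0.
Qed.

(** * Sampling at the Padua points of the torus *)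

Definition num_nodes n := (2 * n * n.+1)%N.

(** The corner [(-n, 0)] is left out because it agrees with [(n, 0)] on the
    nodes. *)
Definition diamond n : pred freq :=
  [pred al | (`|al.1| + `|al.2| <= n%:Z) && (- n%:Z < al.1)].

(** Frequencies that agree on the nodes differ by [(n u, (n+1) v)] with [u + v]
    even; the difference of two points of the diamond has [l^1] size at most [2n],
    which leaves only [u = v = 0] and the pair of corners [(n, 0)], [(-n, 0)], of
    which the second is excluded. *)
Lemma diamond_alias n al be : (0 < n)%N -> diamond n al -> diamond n be ->
  (num_nodes n %| (be.1 - al.1) * n.+1%:Z + (be.2 - al.2) * n%:Z)%Z -> be = al.
Proof.
case: al => a1 a2; case: be => b1 b2 n0 /andP[/= ha ha'] /andP[/= hb hb'] d.
have : (n%:Z %| (b1 - a1) * n.+1%:Z)%Z.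
  have := dvdz_trans (_ : (n%:Z %| Posz (num_nodes n))%Z) d.
  rewrite dvdzE /num_nodes /= -mulnA mulnCA dvdn_mulr// => /(_ isT).
  by rewrite rpredDr// dvdz_mull.
rewrite Gauss_dvdzl; last by rewrite coprimezE /= coprimenS.
move=> /dvdzP[u uE].
have : (n.+1%:Z %| (b2 - a2) * n%:Z)%Z.
  have := dvdz_trans (_ : (n.+1%:Z %| Posz (num_nodes n))%Z) d.
  rewrite dvdzE /num_nodes /= dvdn_mull// => /(_ isT).
  by rewrite rpredDl// dvdz_mull.
rewrite Gauss_dvdzl; last by rewrite coprimezE /= coprimeSn.
move=> /dvdzP[v vE].
move: d => /dvdzP[w]; rewrite uE vE /num_nodes !PoszM => wE.
have uv : u + v = 2 * w.
  apply: (@mulfI _ (n%:Z * n.+1%:Z)); first by rewrite mulf_neq0// -lt0n.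
  by move: wE; nia.
have h : `|u| * n%:Z + `|v| * n.+1%:Z <= 2 * n%:Z.
  have -> : `|u| * n%:Z = `|b1 - a1| by rewrite uE normrM.
  have -> : `|v| * n.+1%:Z = `|b2 - a2| by rewrite vE normrM.
  by lia.
have v2 : `|v| < 2.
  rewrite ltNge; apply/negP => v2.
  have := ler_wpM2r (_ : 0 <= n.+1%:Z) v2; have : 0 <= `|u| * n%:Z by rewrite mulr_ge0.
  by move=> k /(_ isT); lia.
have v0 : v = 0.
  have [//|vn0] := eqVneq v 0.
  have u1 : 1 <= `|u| by lia.
  have v1 : 1 <= `|v| by lia.
  have := ler_wpM2r (_ : 0 <= n%:Z) u1; have := ler_wpM2r (_ : 0 <= n.+1%:Z) v1.
  by move=> /(_ isT) k1 /(_ isT) k2; lia.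
have u0 : u = 0.
  have [//|un0] := eqVneq u 0.
  have u2 : 2 <= `|u| by lia.
  have := ler_wpM2r (_ : 0 <= n%:Z) u2 => /(_ isT) k.
  have : `|u| * n%:Z = `|b1 - a1| by rewrite uE normrM.
  by lia.
by move: uE vE; rewrite u0 v0 !mul0r => /eqP + /eqP; rewrite !subr_eq0 => /eqP-> /eqP->.
Qed.

Section Sampling.
Context {R : realType}.
Local Notation C := R[i].
Implicit Types (x : R * R) (al be : freq) (n t : nat) (g : R * R -> C).

Definition padua_node n t : R * R := (t%:R * (pi / n%:R), t.+1%:R * (pi / n.+1%:R)).

Lemma sum_padua_node_chi n al : (0 < n)%N ->
  \sum_(t < num_nodes n) chi al (padua_node n t) =
    if (num_nodes n %| al.1 * n.+1%:Z + al.2 * n%:Z)%Z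
    then cis (al.2%:~R * (pi / n.+1%:R)) * (num_nodes n)%:R else 0.
Proof.
move=> n0; have nR : n%:R != 0 :> R by rewrite pnatr_eq0 -lt0n.
transitivity (\sum_(t < num_nodes n) cis (al.2%:~R * (pi / n.+1%:R)) *
   cis ((al.1 * n.+1%:Z + al.2 * n%:Z)%:~R * (t%:R * (2 * pi / (num_nodes n)%:R))) : C).
  apply: eq_bigr => t _; rewrite -cisD /chi /padua_node /=; congr cis.
  rewrite intrD !intrM -!pmulrn /num_nodes !natrM -[t.+1%:R]natr1; field.
  by rewrite nR nat1r pnatr_eq0.
rewrite -mulr_sumr sum_cis ?muln_gt0 ?n0//.
by case: ifP => // _; rewrite mulr0.
Qed.

Definition node_coef n g al : C :=
  (num_nodes n)%:R^-1 * \sum_(t < num_nodes n) g (padua_node n t) * Num.conj (chi al (padua_node n t)).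

(** Discrete orthogonality of the characters in the reduced diamond. *)
Lemma node_coef_trig (K : finType) (p : K -> C) (fr : K -> freq) n al : (0 < n)%N ->
  (forall k, diamond n (fr k)) -> diamond n al ->
  node_coef n (trig_sum p fr predT) al = \sum_(k | fr k == al) p k.
Proof.
move=> n0 Dfr Dal; have N0 : (num_nodes n)%:R != 0 :> C by rewrite pnatr_eq0 -lt0n !muln_gt0 n0.
rewrite /node_coef /trig_sum; under eq_bigr do rewrite mulr_suml.
rewrite exchange_big /= mulr_sumr [RHS]big_mkcond; apply: eq_bigr => k _.
transitivity ((num_nodes n)%:R^-1 * (p k * \sum_(t < num_nodes n) chi (freqD (fr k) (freqN al)) (padua_node n t))).
  congr (_ * _); rewrite mulr_sumr; apply: eq_bigr => t _.
  by rewrite conj_chi chiD mulrA.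
rewrite sum_padua_node_chi//=; case: eqVneq => [->|ne].
  by rewrite !subrr !mul0r dvdz0 cis0 mul1r mulrC mulfK.
case: ifP => [/(diamond_alias n0 Dal (Dfr k)) E|]; last by rewrite !mulr0.
by rewrite E eqxx in ne.
Qed.

Definition quasi_freq n (i : vdp_idx n * vdp_idx n.+1) : freq := (vdp_freq i.1, vdp_freq i.2).

Definition quasi_coef n g (i : vdp_idx n * vdp_idx n.+1) : C :=
  node_coef n g (quasi_freq i) / (n * n.+1)%:R.

(** The convolution of the values of [g] at the nodes with the product kernel,
    see [quasiE]; this presentation displays its frequencies. *)
Definition quasi n g x : C := trig_sum (@quasi_coef n g) (@quasi_freq n) predT x.

Lemma quasiE n g x : quasi n g x = (num_nodes n)%:R^-1 * \sum_(t < num_nodes n)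
  g (padua_node n t) * (vdp n (x.1 - (padua_node n t).1) * vdp n.+1 (x.2 - (padua_node n t).2)).
Proof.
rewrite /quasi /trig_sum /quasi_coef /node_coef.
transitivity (\sum_(i : vdp_idx n * vdp_idx n.+1) \sum_(t < num_nodes n)
   (num_nodes n)%:R^-1 * (g (padua_node n t) * (n%:R^-1 * n.+1%:R^-1 *
     (cis ((vdp_freq i.1)%:~R * (x.1 - (padua_node n t).1)) *
      cis ((vdp_freq i.2)%:~R * (x.2 - (padua_node n t).2))))) : C).
  apply: eq_bigr => i _; rewrite mulr_sumr !mulr_suml; apply: eq_bigr => t _.
  rewrite -cisD [cis _](_ : _ = chi (quasi_freq i) x * Num.conj (chi (quasi_freq i) (padua_node n t))).
    by rewrite natrM invfM; ring.
  by rewrite conj_chi /chi -cisD /= !intrN; congr cis; ring.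
rewrite exchange_big mulr_sumr; apply: eq_bigr => t _.
rewrite -!mulr_sumr; congr (_ * (_ * _)).
rewrite /vdp [RHS]mulrACA; congr (_ * _).
by rewrite big_distrlr pair_bigA.
Qed.

(** The nodes are half of the product grid of size [2n * 2(n+1)], and each
    one-dimensional kernel has grid mean at most [5/2]; the constant is
    [2 * (5/2)^2 = 25/2]. *)
Lemma quasi_le n g x (E : C) : (0 < n)%N -> (forall t, `|g (padua_node n t)| <= E) ->
  2 * `|quasi n g x| <= 25 * E.
Proof.
move=> n0 gE; have E0 : 0 <= E by apply: le_trans (gE 0%N).
have N0 : 0 < (num_nodes n)%:R :> C by rewrite ltr0n !muln_gt0 n0.
rewrite -(ler_pM2l N0) quasiE normrM normfV normr_nat mulrCA mulVKf ?lt0r_neq0//.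
pose h1 t := `|vdp n (x.1 - t%:R * (pi / n%:R))|.
pose h2 t := `|vdp n.+1 (x.2 - t%:R * (pi / n.+1%:R))|.
apply: (@le_trans _ _ (2 * (\sum_(t < num_nodes n) E * (h1 t * h2 t.+1)))).
  rewrite ler_pM2l//; apply: (le_trans (ler_norm_sum _ _ _)).
  apply: ler_sum => t _; rewrite normrM [X in _ * X]normrM.
  by apply: ler_wpM2r; [exact: mulr_ge0|exact: gE].
apply: (@le_trans _ _ (2 * (E * ((5 * n)%:R * (5 * n.+1)%:R)))); last first.
  by rewrite /num_nodes !natrM le_eqVlt; apply/orP; left; apply/eqP; ring.
rewrite ler_pM2l// -mulr_sumr ler_wpM2l//.
have per (k : nat) (y : R) a : (0 < k)%N ->
    `|vdp k (y - a%:R * (pi / k%:R))| =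
    `|vdp k (y - (a %% (2 * k))%:R * (pi / k%:R))|.
  move=> k0; have kR : k%:R != 0 :> R by rewrite pnatr_eq0 -lt0n.
  rewrite {1}(divn_eq a (2 * k)) -(vdp_periodic k (y - (a %% (2 * k))%:R * _) (a %/ (2 * k))).
  by congr (`|vdp k _|); rewrite natrD !natrM; field.
apply: le_trans (sum_crt_le n0 _ _ _ _) _.
- by move=> a; exact: normr_ge0.
- by move=> a; exact: normr_ge0.
- by move=> a; exact: per.
- by move=> a; exact: per.
- by apply: ler_pM; [apply: sumr_ge0 => a _; exact: normr_ge0|apply: sumr_ge0 => a _; exact: normr_ge0|exact: sum_vdp|exact: sum_vdp].
Qed.

(** On the diamond the product kernel has coefficient 1 and the discrete
    coefficients of [g] are its true coefficients, so the projection of the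
    quasi-interpolant onto the diamond is [g]. *)
Lemma diamond_quasi (K : finType) (p : K -> C) (fr : K -> freq) n x : (0 < n)%N ->
  (forall k, diamond n (fr k)) ->
  trig_sum (@quasi_coef n (trig_sum p fr predT)) (@quasi_freq n) [pred i | diamond n (quasi_freq i)] x
    = trig_sum p fr predT x.
Proof.
move=> n0 Dfr; rewrite /trig_sum /quasi_coef.
have nn0 : (n * n.+1)%:R != 0 :> C by rewrite pnatr_eq0 muln_eq0; lia.
transitivity (\sum_(k : K) \sum_(i : vdp_idx n * vdp_idx n.+1 | quasi_freq i == fr k)
    p k * chi (fr k) x / (n * n.+1)%:R).
  rewrite [LHS](eq_bigr (fun i => \sum_(k | fr k == quasi_freq i) p k * chi (fr k) x / (n * n.+1)%:R)); last first.
    move=> i Di; rewrite -[in LHS]/(trig_sum p fr predT) node_coef_trig// !mulr_suml.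
    by apply: eq_bigr => k /eqP ->; ring.
  rewrite (exchange_big_dep xpredT)//=; apply: eq_bigr => k _.
  apply: eq_bigl => i; rewrite eq_sym; case: eqVneq => [E|]; last by rewrite andbF.
  by rewrite E Dfr.
apply: eq_bigr => k _; have /andP[/= d1 _] := Dfr k.
have cnt : \sum_(i : vdp_idx n * vdp_idx n.+1 | quasi_freq i == fr k) 1 = (n * n.+1)%:R :> C.
  rewrite natrM -(@vdp_freq_count R n (fr k).1) -?(@vdp_freq_count R n.+1 (fr k).2); try lia.
  rewrite big_distrlr /= pair_big /=; apply: eq_big => [[i j]|? _]; last by rewrite mulr1.
  by case: (fr k) => a b; rewrite xpair_eqE.
transitivity ((\sum_(i : vdp_idx n * vdp_idx n.+1 | quasi_freq i == fr k) 1) *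
    (p k * chi (fr k) x / (n * n.+1)%:R)).
  by rewrite mulr_suml; apply: eq_bigr => i _; rewrite mul1r.
by rewrite cnt mulrC divfK.
Qed.

Definition sampling_const m : C := riesz_const m ^+ 5 * (25 / 2) ^+ (m + m).

(** Five half-planes cut out the reduced diamond: its four sides and the line
    that removes the corner [(-n, 0)]. *)
Lemma sampling_le (K : finType) (p : K -> C) (fr : K -> freq) n m M (E : C) :
  (0 < n)%N -> (0 < m)%N -> ((2 * n.+1) * m + (2 * n.+1) * m < M)%N ->
  (forall k, diamond n (fr k)) ->
  (forall t, `|trig_sum p fr predT (padua_node n t)| <= E) ->
  \sum_(b : 'I_M * 'I_M) `|trig_sum p fr predT (gridpt b)| ^+ (m + m) <=
    sampling_const m * E ^+ (m + m) * (M * M)%:R.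
Proof.
move=> n0 m0 mM Dfr gE; set g := trig_sum p fr predT.
have K1 (i : vdp_idx n * vdp_idx n.+1) : `|(quasi_freq i).1| <= (2 * n.+1)%N%:Z.
  by have := vdp_freq_bound i.1; rewrite /quasi_freq /=; lia.
have K2 (i : vdp_idx n * vdp_idx n.+1) : `|(quasi_freq i).2| <= (2 * n.+1)%N%:Z.
  exact: (vdp_freq_bound i.2).
pose Z P := \sum_(b : 'I_M * 'I_M) `|trig_sum (@quasi_coef n g) (@quasi_freq n) P (gridpt b)| ^+ (m + m).
have step P u s X : Z P <= X ->
    Z [pred i | P i && (s < slope u (quasi_freq i))] <= riesz_const m * X.
  move=> PX; apply: (le_trans (riesz_halfplane _ P u s m0 mM K1 K2)).
  by rewrite ler_wpM2l// riesz_const_ge0.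
have Z0 : Z predT <= ((25 / 2) * E) ^+ (m + m) * (M * M)%:R.
  apply: (@le_trans _ _ (\sum_(b : 'I_M * 'I_M) ((25 / 2) * E) ^+ (m + m))).
    apply: ler_sum => b _; apply: lerXn2r; rewrite ?nnegrE//.
      by rewrite mulr_ge0// (le_trans _ (gE 0%N)).
    by rewrite mulrAC ler_pdivlMr// mulrC; exact: quasi_le.
  by rewrite sumr_const card_prod !card_ord mulr_natr.
have := step _ (1, 0) (- n%:Z) _ (step _ (1, -1) (- n%:Z - 1) _ (step _ (-1, 1) (- n%:Z - 1) _
  (step _ (1, 1) (- n%:Z - 1) _ (step _ (-1, -1) (- n%:Z - 1) _ Z0)))).
set P5 := (X in Z X).
have -> : P5 = [pred i | diamond n (quasi_freq i)].
  apply/funext => i; rewrite /P5 /diamond /slope /=.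
  by case: (quasi_freq i) => a b /=; apply/idP/idP; lia.
rewrite /Z; under eq_bigr do rewrite diamond_quasi//.
move=> h; apply: (le_trans h); rewrite /sampling_const exprMn le_eqVlt; apply/orP; left.
by apply/eqP; ring.
Qed.

End Sampling.

(** * Bivariate Chebyshev expansions *)

Section ChebRing.
Context {A : comNzRingType}.
Implicit Types (x : A) (k : nat).

(** Chebyshev polynomials of the first kind in any commutative ring, so that the
    same recursion yields polynomials and their values; the pair holds two
    consecutive ones. *)
Fixpoint cheb_pair x k : A * A :=
  if k is k'.+1 then ((cheb_pair x k').2, 2 * x * (cheb_pair x k').2 - (cheb_pair x k').1)
  else (1, x).

Definition cheb x k := (cheb_pair x k).1.

Lemma cheb0 x : cheb x 0 = 1. Proof. by []. Qed.

Lemma cheb1 x : cheb x 1 = x. Proof. by []. Qed.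

Lemma chebSS x k : cheb x k.+2 = 2 * x * cheb x k.+1 - cheb x k.
Proof. by []. Qed.

Lemma cheb_ind (P : nat -> Prop) : P 0%N -> P 1%N ->
  (forall k, P k -> P k.+1 -> P k.+2) -> forall k, P k.
Proof.
move=> P0 P1 PS k; suff : P k /\ P k.+1 by case.
by elim: k => [|k [IH1 IH2]]; split=> //; exact: PS.
Qed.

End ChebRing.

Lemma rmorph_cheb (A B : comNzRingType) (f : {rmorphism A -> B}) x k :
  f (cheb x k) = cheb (f x) k.
Proof.
elim/cheb_ind: k => [||k IH1 IH2]; rewrite ?rmorph1//.
by rewrite !chebSS rmorphB !rmorphM rmorph_nat IH1 IH2.
Qed.

Lemma cheb_cos (R : realType) (t : R) k : cheb (cos t) k = cos (k%:R * t).
Proof.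
elim/cheb_ind: k => [||k IH1 IH2]; rewrite ?mul0r ?cos0 ?mul1r//.
rewrite chebSS IH1 IH2.
have -> : k.+2%:R * t = k.+1%:R * t + t by rewrite -[k.+2%:R]natr1; ring.
have -> : k%:R * t = k.+1%:R * t - t by rewrite -[k.+1%:R]natr1; ring.
by rewrite !cosD cosN sinN; ring.
Qed.

Section Bivariate.
Context {R : realType}.
Implicit Types (P Q : poly2 R) (k l n : nat).

Definition Xvar (i : 'I_2) : poly2 R := mpolyX R (mnm1 i).

Definition cheb2 k l : poly2 R := cheb (Xvar ord0) k * cheb (Xvar ord_max) l.

Lemma eval2_cheb2 k l (x : R * R) :
  eval2 (cheb2 k l) x = cheb x.1 k * cheb x.2 l.
Proof.
by rewrite /eval2 /cheb2 mevalM !(rmorph_cheb (meval _)) /= /Xvar !mevalXU.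
Qed.

Lemma Pi2_mul a b P Q : Pi2 a P -> Pi2 b Q -> Pi2 (a + b) (P * Q).
Proof.
rewrite /Pi2 /= => ha hb.
have [->|P0] := eqVneq P 0; first by rewrite mul0r msize0.
have [->|Q0] := eqVneq Q 0; first by rewrite mulr0 msize0.
rewrite msizeM//; move: ha hb; move: (msize P) (msize Q) => p q; lia.
Qed.

Lemma Pi2D n P Q : Pi2 n P -> Pi2 n Q -> Pi2 n (P + Q).
Proof. by rewrite /Pi2/= => hP hQ; apply: (leq_trans (msizeD_le _ _)); rewrite geq_max hP. Qed.

Lemma Pi2Z n (c : R) P : Pi2 n P -> Pi2 n (c *: P).
Proof. by rewrite /Pi2/= => hP; apply: leq_trans hP; exact: msizeZ_le. Qed.

Lemma Pi2_le n n' P : (n <= n')%N -> Pi2 n P -> Pi2 n' P.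
Proof. by rewrite /Pi2/= => nn' /leq_trans; apply; rewrite ltnS. Qed.

Lemma Pi2_sum n (I : finType) (F : I -> poly2 R) :
  (forall i, Pi2 n (F i)) -> Pi2 n (\sum_i F i).
Proof.
move=> h; apply: (big_ind (Pi2 n)) => //; last by move=> *; exact: Pi2D.
by rewrite /Pi2/= msize0.
Qed.

Lemma Pi2_Xvar i : Pi2 1 (Xvar i).
Proof. by rewrite /Pi2 /Xvar /= msizeX mdeg1. Qed.

Lemma Pi2_cheb i k : Pi2 k (cheb (Xvar i) k).
Proof.
elim/cheb_ind: k => [||k IH1 IH2].
- by rewrite /Pi2 /= msize1.
- exact: Pi2_Xvar.
- rewrite chebSS; apply: Pi2D.
    rewrite -mulrA mulr_natl -scaler_nat; apply: Pi2Z.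
    by have := Pi2_mul (Pi2_Xvar i) IH2.
  rewrite -scaleN1r; apply: Pi2Z; apply: Pi2_le IH1; lia.
Qed.

Lemma Pi2_cheb2 n k l : (k + l <= n)%N -> Pi2 n (cheb2 k l).
Proof. by move=> /Pi2_le; apply; apply: Pi2_mul; exact: Pi2_cheb. Qed.

Definition triangle n : finType := {kl : 'I_n.+1 * 'I_n.+1 | (kl.1 + kl.2 <= n)%N}.

Definition triangle_fst n (i : triangle n) : nat := (val i).1.
Definition triangle_snd n (i : triangle n) : nat := (val i).2.

Lemma triangle_le n (i : triangle n) : (triangle_fst i + triangle_snd i <= n)%N.
Proof. exact: valP i. Qed.

Definition cheb_sum n (d : triangle n -> R) : poly2 R :=
  \sum_(i : triangle n) d i *: cheb2 (triangle_fst i) (triangle_snd i).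

Definition cheb_span n P := exists d : triangle n -> R, P = cheb_sum d.

Lemma Pi2_cheb_sum n (d : triangle n -> R) : Pi2 n (cheb_sum d).
Proof. by apply: Pi2_sum => i; apply/Pi2Z/Pi2_cheb2/triangle_le. Qed.

Lemma cheb_span_cheb2 n k l : (k + l <= n)%N -> cheb_span n (cheb2 k l).
Proof.
move=> kln; have kn : (k < n.+1)%N by lia.
have ln : (l < n.+1)%N by lia.
pose i0 : triangle n := exist _ (Ordinal kn, Ordinal ln) kln.
exists (fun i => (i == i0)%:R); rewrite /cheb_sum (bigD1 i0)//= eqxx scale1r.
by rewrite big1 ?addr0// => i /negPf->; rewrite scale0r.
Qed.

Lemma cheb_spanD n P Q : cheb_span n P -> cheb_span n Q -> cheb_span n (P + Q).
Proof.
move=> [d ->] [e ->]; exists (fun i => d i + e i).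
by rewrite /cheb_sum -big_split; apply: eq_bigr => i _; rewrite scalerDl.
Qed.

Lemma cheb_spanZ n (c : R) P : cheb_span n P -> cheb_span n (c *: P).
Proof.
move=> [d ->]; exists (fun i => c * d i).
by rewrite /cheb_sum scaler_sumr; apply: eq_bigr => i _; rewrite scalerA.
Qed.

Lemma cheb_span_sum n (I : Type) (r : seq I) (B : pred I) (F : I -> poly2 R) :
  (forall i, B i -> cheb_span n (F i)) -> cheb_span n (\sum_(i <- r | B i) F i).
Proof.
move=> h; apply: (big_ind (cheb_span n)) => //; last by move=> *; exact: cheb_spanD.
by exists (fun=> 0); rewrite /cheb_sum big1// => i _; rewrite scale0r.
Qed.

Lemma cheb_span_le n n' P : (n <= n')%N -> cheb_span n P -> cheb_span n' P.
Proof.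
move=> nn' [d ->]; apply: cheb_span_sum => i _; apply/cheb_spanZ/cheb_span_cheb2.
exact: leq_trans (triangle_le i) nn'.
Qed.

Lemma mul_cheb (x : poly2 R) k : x * cheb x k.+1 = 2^-1 *: cheb x k.+2 + 2^-1 *: cheb x k.
Proof.
rewrite -scalerDr chebSS subrK -mulrA mulr_natl.
have -> : x * cheb x k.+1 *+ 2 = (2 : R) *: (x * cheb x k.+1) by rewrite scaler_nat.
by rewrite scalerA mulVf ?scale1r// pnatr_eq0.
Qed.

(** Multiplication by a variable raises the degree by one inside the Chebyshev
    span, because [2 x T_(k+1) = T_(k+2) + T_k]. *)
Lemma cheb_span_mulX n i P : cheb_span n P -> cheb_span n.+1 (Xvar i * P).
Proof.
move=> [d ->]; rewrite mulr_sumr; apply: cheb_span_sum => t _.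
rewrite -scalerAr; apply: cheb_spanZ; have := triangle_le t.
move: (triangle_fst t) (triangle_snd t) => k l kl.
have [->|->] : i = ord0 \/ i = ord_max.
  by case: i => [[|[|//]] hi]; [left|right]; apply/val_inj.
- rewrite /cheb2 mulrA; case: k kl => [|k] kl.
    rewrite cheb0 mulr1 -{1}[Xvar ord0]cheb1 -/(cheb2 1 l).
    by apply: cheb_span_cheb2; lia.
  rewrite mul_cheb mulrDl -!scalerAl.
  by apply: cheb_spanD; apply/cheb_spanZ/cheb_span_cheb2; lia.
- rewrite /cheb2 mulrCA; case: l kl => [|l] kl.
    rewrite cheb0 mulr1 -{1}[Xvar ord_max]cheb1 -/(cheb2 k 1).
    by apply: cheb_span_cheb2; lia.
  rewrite mul_cheb mulrDr -!scalerAr.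
  by apply: cheb_spanD; apply/cheb_spanZ/cheb_span_cheb2; lia.
Qed.

Lemma cheb_span_XX a b : cheb_span (a + b) (Xvar ord0 ^+ a * Xvar ord_max ^+ b).
Proof.
elim: a => [|a IH]; last by rewrite addSn exprS -mulrA; exact: cheb_span_mulX.
rewrite mul1r; elim: b => [|b IH]; last by rewrite exprS; exact: cheb_span_mulX.
by have := @cheb_span_cheb2 0 0 0 isT; rewrite /cheb2 mulr1.
Qed.

Lemma Pi2_cheb_span n P : Pi2 n P -> cheb_span n P.
Proof.
rewrite /Pi2 /= => Pn; rewrite (mpolyE P) big_seq_cond.
apply: cheb_span_sum => m /andP[mP _]; apply: cheb_spanZ.
have := leq_trans (msize_mdeg_lt mP) Pn; rewrite ltnS.
rewrite mdegE mpolyXE_id !big_ord_recl !big_ord0 mulr1 addn0 => /cheb_span_le; apply.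
rewrite (_ : lift ord0 ord0 = ord_max); last exact/val_inj.
exact: cheb_span_XX.
Qed.

Lemma eval2_cheb_sum n (d : triangle n -> R) (x : R * R) :
  eval2 (cheb_sum d) (cos x.1, cos x.2) =
  \sum_(i : triangle n) d i * (cos ((triangle_fst i)%:R * x.1) * cos ((triangle_snd i)%:R * x.2)).
Proof.
rewrite /eval2 /cheb_sum raddf_sum; apply: eq_bigr => i _.
by rewrite /= mevalZ; have := eval2_cheb2 (triangle_fst i) (triangle_snd i) (cos x.1, cos x.2); rewrite /eval2 => ->; rewrite !cheb_cos.
Qed.

End Bivariate.

(** * Lifting an algebraic polynomial to the torus *)

Section Lift.
Context {R : realType}.
Local Notation C := R[i].
Implicit Types (n : nat) (x : R * R).

Definition lift_idx n : finType := (triangle n * bool * bool)%type.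

Definition sign_mul (s : bool) (k : nat) : int := if s then k%:Z else - k%:Z.

(** The product [cos(k t) cos(l u)] is the mean of four exponentials.  For
    [k = n], hence [l = 0], the frequency [(-n, 0)] is replaced by [(n, 0)]. *)
Definition lift_freq n (i : lift_idx n) : freq :=
  let k := triangle_fst i.1.1 in (if k == n then k%:Z else sign_mul i.1.2 k, sign_mul i.2 (triangle_snd i.1.1)).

Definition lift_coef n (d : triangle n -> R) (i : lift_idx n) : C := real_complex R (d i.1.1 / 4).

Lemma lift_freq_diamond n (i : lift_idx n) : (0 < n)%N -> diamond n (lift_freq i).
Proof.
move=> n0; case: i => -[t s1] s2; rewrite /diamond /lift_freq /=.
have := triangle_le t; move: (triangle_fst t) (triangle_snd t) => k l kl.
by case: eqVneq => kn; case: s1; case: s2; rewrite /sign_mul; lia.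
Qed.

Lemma trig_liftE n (d : triangle n -> R) x : trig_sum (lift_coef d) (@lift_freq n) predT x =
  \sum_(t : triangle n) real_complex R (d t) *
    (if triangle_fst t == n then cis (n%:R * x.1)
     else real_complex R (cos ((triangle_fst t)%:R * x.1) * cos ((triangle_snd t)%:R * x.2))).
Proof.
transitivity (\sum_(t : triangle n) \sum_(s1 : bool) \sum_(s2 : bool)
   lift_coef d (t, s1, s2) * chi (lift_freq (t, s1, s2)) x).
  by rewrite pair_bigA pair_bigA; apply: eq_bigr => -[[t s1] s2].
apply: eq_bigr => t _; rewrite !big_bool /lift_coef /lift_freq/=.
have := triangle_le t; move: (triangle_fst t) (triangle_snd t) => k l kl.
rewrite rmorphM.
case: eqVneq => [kn|kn].
  have l0 : l = 0%N by lia.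
  rewrite l0 /sign_mul oppr0 -!mulrDr -!mulrA; congr (_ * _).
  rewrite /chi /= mul0r addr0 kn -pmulrn.
  by apply/eqP; rewrite eq_complex /=; apply/andP; split; apply/eqP; field.
rewrite -!mulrDr -!mulrA; congr (_ * _).
rewrite /chi /sign_mul /= !intrN -!pmulrn !mulNr.
apply/eqP; rewrite eq_complex /=; apply/andP; split; apply/eqP.
  by rewrite !(cosD, cosN, sinN); field.
by rewrite !(sinD, cosN, sinN); field.
Qed.

Lemma Re_trig_lift n (d : triangle n -> R) x : (0 < n)%N ->
  complex.Re (trig_sum (lift_coef d) (@lift_freq n) predT x) = eval2 (cheb_sum d) (cos x.1, cos x.2).
Proof.
move=> n0; rewrite trig_liftE eval2_cheb_sum.
rewrite (raddf_sum (@complex.Re R)); apply: eq_bigr => t _.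
rewrite /=; case: eqVneq => [kn|_] /=; last by rewrite mul0r subr0.
have -> : triangle_snd t = 0%N by have := triangle_le t; lia.
by rewrite kn mul0r mul0r cos0 subr0 mulr1.
Qed.

Lemma sin_natpi t : sin (t%:R * pi) = 0 :> R.
Proof.
elim: t => [|t IH]; first by rewrite mul0r sin0.
by rewrite -natr1 mulrDl mul1r sinDpi IH oppr0.
Qed.

Lemma trig_lift_node n (d : triangle n -> R) t : (0 < n)%N ->
  trig_sum (lift_coef d) (@lift_freq n) predT (padua_node n t) =
  real_complex R (eval2 (cheb_sum d) (cos (padua_node n t).1, cos (padua_node n t).2)).
Proof.
move=> n0; rewrite trig_liftE eval2_cheb_sum rmorph_sum; apply: eq_bigr => i _.
rewrite [RHS]rmorphM; congr (_ * _).
case: eqVneq => [kn|_] //; have -> : triangle_snd i = 0%N by have := triangle_le i; lia.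
rewrite kn mul0r cos0 mulr1 /cis /padua_node /=.
have -> : n%:R * (t%:R * (pi / n%:R)) = t%:R * pi :> R by field; rewrite pnatr_eq0 -lt0n.
by rewrite sin_natpi.
Qed.

Definition padua_const m : R := complex.Re (@sampling_const R m).

(** The polynomial is the real part of its lift, and the two agree at the nodes,
    so the bound for the lift descends. *)
Lemma padua_grid_le n m M (d : triangle n -> R) (E : R) : (0 < n)%N -> (0 < m)%N ->
  ((2 * n.+1) * m + (2 * n.+1) * m < M)%N ->
  (forall t, `|eval2 (cheb_sum d) (cos (@padua_node R n t).1, cos (padua_node n t).2)| <= E) ->
  \sum_(b : 'I_M * 'I_M)
     eval2 (cheb_sum d) (cos (@gridpt R M b).1, cos (gridpt b).2) ^+ (m + m) <=
  padua_const m * E ^+ (m + m) * (M * M)%:R.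
Proof.
move=> n0 m0 mM dE.
have := @sampling_le R _ (lift_coef d) (@lift_freq n) n m M (real_complex R E) n0 m0 mM
  (fun i => lift_freq_diamond i n0).
have h t : `|trig_sum (lift_coef d) (@lift_freq n) predT (padua_node n t)| <= real_complex R E.
  rewrite trig_lift_node// normc_def /= expr0n /= addr0 sqrtr_sqr lecR.
  exact: dE.
move=> /(_ h); rewrite lecE => /andP[_].
rewrite /padua_const -[(M * M)%:R](rmorph_nat (real_complex R)) -rmorphXn -mulrA -rmorphM.
set r := E ^+ _ * _; have -> z : complex.Re (z * real_complex R r) = complex.Re z * r.
  by case: z => a b /=; rewrite mulr0 subr0.
rewrite mulrA; apply: le_trans.
rewrite (raddf_sum (@complex.Re R)); apply: ler_sum => b _.
have -> : (`|trig_sum (lift_coef d) (@lift_freq n) predT (gridpt b)| ^+ (m + m)) =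
   real_complex R ((Num.sqrt (complex.Re (trig_sum (lift_coef d) (@lift_freq n) predT (gridpt b)) ^+ 2 +
    complex.Im (trig_sum (lift_coef d) (@lift_freq n) predT (gridpt b)) ^+ 2)) ^+ (m + m)).
  by rewrite rmorphXn /= normc_def.
rewrite -Re_trig_lift// [complex.Re (real_complex _ _)]/= addnn -mul2n !exprM sqr_sqrtr ?addr_ge0 ?sqr_ge0//.
by rewrite lerXn2r ?nnegrE ?addr_ge0 ?sqr_ge0// lerDl sqr_ge0.
Qed.

(** The coefficient of the lift at the frequency of the term [i] is a positive
    multiple of [d i], since only copies of that term contribute; and it is a mean
    of node values. *)
Lemma cheb_sum_inj n (d : triangle n -> R) : (0 < n)%N ->
  (forall t, eval2 (cheb_sum d) (cos (@padua_node R n t).1, cos (padua_node n t).2) = 0) ->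
  forall i, d i = 0.
Proof.
move=> n0 d0 i.
have := node_coef_trig (lift_coef d) n0 (fun i => lift_freq_diamond i n0) (lift_freq_diamond (i, true, true) n0).
rewrite /node_coef big1 => [|t _]; last by rewrite trig_lift_node// d0 mul0r.
rewrite mulr0 (eq_bigr (fun=> real_complex R (d i / 4))); last first.
  move=> [[j s1] s2]; rewrite /lift_freq /lift_coef /sign_mul /= => /eqP[e1 e2].
  suff -> : j = i by [].
  apply/val_inj; move: e1 e2; rewrite /triangle_fst /triangle_snd; case: (val j) (val i) => [a b] [a' b'] /= e1 e2.
  by congr pair; apply/val_inj => /=; [move: e1|move: e2]; do ?case: ifP; do ?case: ifP; lia.
rewrite sumr_const => /esym/eqP; rewrite mulrn_eq0 => /orP[|].
  move=> /eqP h; have := @card0_eq _ _ h (i, true, true).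
  by rewrite unfold_in /= !eqxx.
by rewrite (inj_eq (@complexI R)) ?fmorph_eq0 mulf_eq0 invr_eq0 pnatr_eq0 orbF => /eqP.
Qed.

End Lift.

(** * Existence and uniqueness of the interpolant *)

(** Reducing modulo [2m] and reflecting at [m] both preserve parity. *)
Lemma cos_fold (R : realType) m t : (0 < m)%N -> exists k : nat,
  [/\ (k <= m)%N, odd k = odd t & cos (t%:R * (pi / m%:R)) = cos (k%:R * (pi / m%:R)) :> R].
Proof.
move=> m0; have mR : m%:R != 0 :> R by rewrite pnatr_eq0 -lt0n.
have per (y : R) q : cos (y + q%:R * (2 * pi)) = cos y.
  elim: q => [|q IH]; first by rewrite mul0r addr0.
  by rewrite -natr1 -[RHS]IH -[RHS]cosD2pi; congr cos; ring.
set r := (t %% (2 * m))%N; have r2 : (r < 2 * m)%N by rewrite ltn_mod muln_gt0 m0.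
have tE := divn_eq t (2 * m).
have ot : odd r = odd t by rewrite [in RHS]tE oddD !oddM andbF.
have ct : cos (t%:R * (pi / m%:R)) = cos (r%:R * (pi / m%:R)) :> R.
  rewrite tE -/r -[RHS](per _ (t %/ (2 * m))%N) !natrD !natrM; congr cos; field.
  exact: mR.
have [rm|mr] := leqP r m; first by exists r.
exists (2 * m - r)%N; split; first by lia.
  by rewrite oddB ?(ltnW r2)// mul2n odd_double.
rewrite ct natrB 1?ltnW// -cosN -[RHS](per _ 0%N) mul0r addr0.
rewrite -[LHS](per _ 1%N) natrM; congr cos; field.
exact: mR.
Qed.

Section Interpolation.
Context {R : realType}.
Implicit Types (n : nat) (f : R * R -> R).

(** The Padua points are exactly the points [(cos(k pi/n), cos(b pi/(n+1)))] with
    [k <= n], [b <= n + 1] and [k + b] odd; a node has indices [t] and [t + 1],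
    and folding preserves their parities. *)
Lemma padua_node_Pad n t : (0 < n)%N ->
  Pad n (cos (@padua_node R n t).1, cos (@padua_node R n t).2).
Proof.
move=> n0; rewrite /padua_node/=.
have [k [kn ok ->]] := cos_fold R t n0.
have [b [bn ob ->]] := cos_fold R t.+1 (ltn0Sn n).
exists k, (b./2).+1; split=> //.
  have := odd_double_half b; have := odd_double_half n.
  by rewrite /pad_delta ob /= -ok; case: (odd k); case: (odd n) => /=; lia.
rewrite /pad_xi /pad_eta mulrA; congr pair.
have bE : b%:R = (odd b)%:R + 2 * (b./2)%:R :> R.
  by rewrite -natrM -natrD mul2n odd_double_half.
by case: ifP; rewrite ok mulrA bE ob /= => ->; congr (cos (_ * _ / _)); rewrite -natr1 /=; ring.
Qed.

Definition pad_idx n : finType :=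
  {kj : 'I_n.+1 * 'I_n.+2 | (kj.2 < n./2 + 1 + pad_delta n kj.1)%N}.

Lemma card_under (a m : nat) (h : nat -> nat) : (forall k, (k < a)%N -> (h k <= m)%N) ->
  #|{: {kj : 'I_a * 'I_m | (kj.2 < h kj.1)%N}}| = (\sum_(k < a) h k)%N.
Proof.
move=> hm; rewrite card_sig -sum1_card big_mkcond.
transitivity (\sum_(k < a) \sum_(j < m) if (j < h k)%N then 1 else 0)%N.
  by rewrite pair_bigA; apply: eq_bigr => -[k j].
apply: eq_bigr => k _; rewrite -big_mkcond -(big_ord_widen _ (fun=> 1%N)) ?hm//.
by rewrite sum1_card card_ord.
Qed.

Lemma card_pad_idx_le n : (#|pad_idx n| <= #|triangle n|)%N.
Proof.
have sum1 m : (2 * \sum_(k < m) (m - k) = m * m.+1)%N.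
  elim: m => [|m IH]; first by rewrite big_ord0.
  rewrite big_ord_recl /= subn0 mulnDr.
  by rewrite (eq_bigr (fun k : 'I_m => m - k)%N) ?IH//; nia.
have sum2 m : (\sum_(k < m) odd k = m./2)%N.
  elim: m => [|m IH]; first by rewrite big_ord0.
  by rewrite big_ord_recr /= IH uphalf_half addnC.
rewrite (_ : #|triangle n| = \sum_(k < n.+1) (n.+1 - k))%N; last first.
  rewrite -(@card_under _ n.+1); last by move=> k _; exact: leq_subr.
  rewrite !card_sig; apply: eq_card => -[k l]; rewrite !inE /=.
  by have := ltn_ord k; have := ltn_ord l; lia.
rewrite (@card_under _ _ (fun k => n./2 + 1 + pad_delta n k)%N); last first.
  by move=> k _; rewrite /pad_delta; have := odd_double_half n; case: (odd n) => /=; case: (odd k) => /=; lia.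
rewrite -(leq_pmul2l (isT : (0 < 2)%N)) sum1 big_split sum_nat_const card_ord /=.
rewrite /pad_delta; have := odd_double_half n; case: (odd n) => /= nE.
  rewrite (eq_bigr (fun k : 'I_n.+1 => odd k : nat)) => [|k _]; last by case: odd.
  rewrite sum2; have : (n.+1./2 = n./2 + 1)%N by lia.
  by move=> ->; nia.
by rewrite big1 => [|k _ //]; nia.
Qed.

Definition pad_pt n (i : pad_idx n) : R * R :=
  (pad_xi n (val i).1, pad_eta n (val i).1 (val i).2.+1).

Lemma Pad_pad_pt n (x : R * R) : Pad n x -> exists i : pad_idx n, x = pad_pt i.
Proof.
move=> [k [[|j] [kn /andP[// _ jn] ->]]].
have k1 : (k < n.+1)%N by [].
have j1 : (j < n.+2)%N.
  by move: jn; rewrite /pad_delta; have := odd_double_half n; case: (odd n) => /=; case: (odd k) => /=; lia.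
by exists (exist (fun kj : 'I_n.+1 * 'I_n.+2 => (kj.2 < n./2 + 1 + pad_delta n kj.1)%N) (Ordinal k1, Ordinal j1) jn).
Qed.

Lemma Pi2_inj n (P Q : poly2 R) : (0 < n)%N -> Pi2 n P -> Pi2 n Q ->
  (forall x, Pad n x -> eval2 P x = eval2 Q x) -> P = Q.
Proof.
move=> n0 nP nQ PQ; apply/eqP; rewrite -subr_eq0; apply/eqP.
have : Pi2 n (P - Q) by rewrite -scaleN1r; apply: Pi2D => //; exact: Pi2Z.
move=> /Pi2_cheb_span[d dE]; rewrite dE /cheb_sum big1// => i _.
rewrite (cheb_sum_inj (d := d) n0) ?scale0r// => t.
by rewrite -dE /eval2 mevalB [X in X - _](PQ _ (padua_node_Pad t n0)) subrr.
Qed.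

(** The evaluation matrix has independent rows by [cheb_sum_inj]; as it has no
    more columns than rows, it is of full rank. *)
Lemma interpolates_exists n f : (0 < n)%N -> exists P : poly2 R, interpolates n f P.
Proof.
move=> n0; pose A : 'M[R]_(#|triangle n|, #|pad_idx n|) :=
  \matrix_(i, j) eval2 (cheb2 (triangle_fst (enum_val i)) (triangle_snd (enum_val i))) (pad_pt (enum_val j)).
pose co (u : 'rV[R]_#|triangle n|) (t : triangle n) := u 0 (enum_rank t).
have uA u j : (u *m A) 0 (enum_rank j) = eval2 (cheb_sum (co u)) (pad_pt j).
  rewrite mxE /eval2 /cheb_sum raddf_sum (reindex_onto (@enum_rank _) (@enum_val _ _)) /=; last first.
    by move=> i _; rewrite enum_valK.
  apply: eq_big => [i|i _]; first by rewrite enum_rankK eqxx.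
  by rewrite mxE !enum_rankK mevalZ.
have Afree : row_free A.
  rewrite -kermx_eq0; apply/rowV0P => u /sub_kermxP uA0.
  apply/rowP => i; rewrite mxE -(enum_valK i); change (co u (enum_val i) = 0).
  apply: (cheb_sum_inj n0) => t.
  by have [j ->] := Pad_pad_pt (padua_node_Pad t n0); rewrite -uA uA0 mxE.
have Afull : row_full A.
  by move: Afree; rewrite /row_full /row_free => /eqP Ar; rewrite eqn_leq rank_leq_col Ar card_pad_idx_le.
have /submxP[u uE] := submx_full (\row_j f (pad_pt (enum_val j))) Afull.
exists (cheb_sum (co u)); split; first exact: Pi2_cheb_sum.
by move=> _ /Pad_pad_pt[j ->]; rewrite -uA -uE mxE enum_rankK.
Qed.

Lemma padua_interpP n f : (0 < n)%N -> interpolates n f (padua_interp n f).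
Proof.
move=> n0; have [P PI] := interpolates_exists f n0.
have : (unique (interpolates n f)) (padua_interp n f).
  apply: xgetPex; exists P; split=> // Q QI.
  apply: (Pi2_inj n0) => //; [exact: PI.1|exact: QI.1|].
  by move=> x xP; rewrite PI.2// QI.2.
by case.
Qed.

End Interpolation.

(** * The arcsine weight *)

Section ArcsineWeight.
Context {R : realType}.
Implicit Types (x : R) (g h : R -> R).
Local Notation mu := (@lebesgue_measure R).

Definition arcsine_density x : R := (Num.sqrt (1 - x ^+ 2))^-1.

Local Notation w := arcsine_density.

Definition open_unit_itv : set R := `]-1, 1[%classic.

Lemma arcsine_ge0 x : 0 <= w x.
Proof. by rewrite invr_ge0 sqrtr_ge0. Qed.

Lemma one_sub_sqr_gt0 x : -1 < x < 1 -> 0 < 1 - x ^+ 2.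
Proof. by move=> /andP[a b]; rewrite (_ : _ - _ = (1 - x) * (x - -1)); [rewrite mulr_gt0 ?subr_gt0|ring]. Qed.

Lemma continuous_arcsine x : -1 < x < 1 -> {for x, continuous w}.
Proof.
move=> x1; apply: cvgV; first by rewrite gt_eqF// sqrtr_gt0 one_sub_sqr_gt0.
apply: (@continuous_comp _ _ _ (fun x : R => 1 - x ^+ 2) Num.sqrt); last exact: sqrt_continuous.
apply: cvgB; first exact: cvg_cst.
exact: exprn_continuous.
Qed.

Lemma integral_arcsine_itv g h (dl : R) : continuous g ->
  (forall t : R, is_derive t 1 h (g t)) -> 0 < dl < pi / 2 ->
  (\int[mu]_(x in `[cos (pi - dl), cos dl]) (g (acos x) * w x)%:E)%E
    = (h (pi - dl) - h dl)%:E.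
Proof.
move=> cg dh /andP[d0 d2]; have p0 := pi_gt0 R.
have i1 : dl \in `[0, pi] by rewrite in_itv/=; apply/andP; split; lra.
have i2 : pi - dl \in `[0, pi] by rewrite in_itv/=; apply/andP; split; lra.
have z0 : (0 : R) \in `[0, pi] by rewrite in_itv/= lexx ltW.
have zp : (pi : R) \in `[0, pi] by rewrite in_itv/= lexx ltW.
have lt1 : cos dl < 1 by rewrite -[ltRHS]cos0 ltr_cos.
have gt1 : -1 < cos (pi - dl) by rewrite -[ltLHS]cospi ltr_cos//; lra.
have ab : cos (pi - dl) < cos dl by rewrite ltr_cos//; lra.
have inn x : cos (pi - dl) <= x <= cos dl -> -1 < x < 1.
  by move=> /andP[a b]; rewrite (lt_le_trans gt1 a) (le_lt_trans b lt1).
have ca x : -1 < x < 1 -> {for x, continuous (@acos R)} by exact: continuous_acos.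
have cha x : -1 < x < 1 -> {for x, continuous (fun x => - h (acos x))}.
  move=> x1; apply: cvgN; apply: (@continuous_comp _ _ _ (@acos R) h); first exact: ca.
  apply: differentiable_continuous; apply/derivable1_diffP.
  by have [] := dh (acos x).
have dF x : -1 < x < 1 -> is_derive x 1 (fun x => - h (acos x)) (g (acos x) * w x).
  move=> x1; have dax := is_derive1_acos x1.
  have := is_derive1_comp (dh (acos x)) dax.
  by move=> /is_deriveN; rewrite mulrN opprK; exact.
rewrite (@continuous_FTC2 R _ (fun x => - h (acos x)) _ _ ab).
- by rewrite !cosK// -EFinD opprK addrC.
- apply: continuous_in_subspaceT => x; rewrite inE/= in_itv/= => /inn x1.
  apply: cvgM; last exact: continuous_arcsine.
  by apply: (@continuous_comp _ _ _ (@acos R) g); [exact: ca|exact: cg].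
- split.
  + move=> x; rewrite in_itv/= => /andP[a b]; by have [] := dF x (inn x (introT andP (conj (ltW a) (ltW b)))).
  + by apply: cvg_at_right_filter; apply: cha; apply: inn; rewrite lexx ltW.
  + by apply: cvg_at_left_filter; apply: cha; apply: inn; rewrite lexx ltW.
- move=> x; rewrite in_itv/= => /andP[a b].
  by rewrite derive1E; have [_ ->] := dF x (inn x (introT andP (conj (ltW a) (ltW b)))).
Qed.

Lemma ler_cos_pi (s t : R) : 0 <= s <= pi -> 0 <= t <= pi ->
  (cos s <= cos t) = (t <= s).
Proof. by move=> hs ht; rewrite !leNgt ltr_cos// in_itv. Qed.

(** The density is unbounded at the endpoints, so the integral is obtained as
    the monotone limit of its values on [cos(pi - d), cos d]. *)
Lemma integral_arcsine g h : continuous g -> (forall t, 0 <= g t) ->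
  (forall t : R, is_derive t 1 h (g t)) ->
  (\int[mu]_(x in open_unit_itv) (g (acos x) * w x)%:E)%E = (h pi - h 0)%:E.
Proof.
move=> cg g0 dh; have p0 := pi_gt0 R.
have hc : continuous h.
  by move=> t; apply: differentiable_continuous; apply/derivable1_diffP; have [] := dh t.
pose dl (i : nat) : R := i.+2%:R^-1.
have dl0 i : 0 < dl i by rewrite invr_gt0 ltr0n.
have dl1 i : dl i <= 1 / 2.
  by rewrite div1r lef_pV2 ?posrE ?ltr0n// ler_nat.
have pi2 : (2 : R) <= pi by exact: pi_ge2.
have dlp i : 0 < dl i < pi / 2 by rewrite dl0/=; have := dl1 i; lra.
pose F i := `[cos (pi - dl i), cos (dl i)]%classic.
have UF : open_unit_itv = \bigcup_i F i.
  apply/seteqP; split=> x; rewrite /open_unit_itv /= in_itv/=.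
    move=> x1; have /andP[a b] := x1.
    have a0 : 0 < acos x by rewrite acos_gt0// ltW.
    have ap : acos x < pi by rewrite acos_ltpi// a ltW.
    pose m := Num.min (acos x) (pi - acos x).
    have m0 : 0 < m by rewrite lt_min a0 subr_gt0.
    have [N Nm] : exists N, dl N <= m.
      exists (Num.bound m^-1); rewrite /dl -[leRHS]invrK lef_pV2 ?posrE ?ltr0n ?invr_gt0//.
      apply: (le_trans (ltW (archi_boundP _))); first by rewrite invr_ge0 ltW.
      by rewrite ler_nat; lia.
    exists N => //; rewrite /F /= in_itv/=.
    move: Nm; rewrite /m le_min => /andP[n1 n2].
    have := dlp N => /andP[q1 q2].
    have -> : x = cos (acos x) by rewrite acosK// in_itv/= !ltW.
    by rewrite !ler_cos_pi//; apply/andP; split; lra.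
  move=> [i _]; rewrite /F /= in_itv/= => /andP[a b].
  have := dlp i => /andP[q1 q2].
  rewrite (lt_le_trans _ a) ?(le_lt_trans b)//.
    by rewrite -[ltRHS]cos0 ltr_cos// in_itv/= ?lexx; apply/andP; split; lra.
  by rewrite -[ltLHS]cospi ltr_cos ?in_itv/=; try (apply/andP; split); lra.
have ndF : {homo F : n m / (n <= m)%N >-> (n <= m)%O}.
  move=> i j ij; apply/subsetPset => x; rewrite /F /= !in_itv/= => /andP[a b].
  have dij : dl j <= dl i by rewrite lef_pV2 ?posrE ?ltr0n// ler_nat.
  have := dlp i => /andP[q1 q2]; have := dlp j => /andP[q3 q4].
  rewrite (le_trans _ a) ?(le_trans b)//.
    by rewrite leNgt ltr_cos ?in_itv/= -?leNgt; try (apply/andP; split); lra.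
  by rewrite leNgt ltr_cos ?in_itv/= -?leNgt; try (apply/andP; split); lra.
have mw : measurable_fun open_unit_itv (fun x => g (acos x) * w x).
  apply: open_continuous_measurable_fun; first exact: interval_open.
  move=> x; rewrite inE /open_unit_itv /= in_itv/= => x1.
  apply: cvgM; last exact: continuous_arcsine.
  by apply: (@continuous_comp _ _ _ (@acos R) g); [exact: continuous_acos|exact: cg].
have FS i : F i `<=` open_unit_itv by rewrite UF; exact: bigcup_sup.
have cvgF : (\int[mu]_(x in F i) (g (acos x) * w x)%:E)%E @[i --> \oo] -->
    (\int[mu]_(x in open_unit_itv) (g (acos x) * w x)%:E)%E.
  rewrite UF; apply: ge0_nondecreasing_set_cvg_integral => //.
  - by move=> i; exact: measurable_itv.
  - move=> i; apply/measurable_EFinP; apply: measurable_funS mw => //; exact: measurable_itv.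
  - by move=> i x _; rewrite lee_fin mulr_ge0 ?arcsine_ge0.
move: cvgF; under eq_cvg do rewrite (integral_arcsine_itv cg dh (dlp _)).
move=> cvgF.
have dlc : dl @ \oo --> 0.
  have := @cvg_harmonic R; rewrite -cvg_shiftS /=; apply: cvg_trans.
  by apply: near_eq_cvg; near=> i.
have hlim : (h (pi - dl i) - h (dl i))%:E @[i --> \oo] --> (h pi - h 0)%:E.
  apply: cvg_EFin; first by near=> i.
  apply: cvgB.
    apply: (@cvg_comp _ _ _ (fun i => pi - dl i) h); last exact: hc.
    have : (fun i => pi - dl i) @ \oo --> pi - 0 by apply: cvgB => //; exact: cvg_cst.
    by rewrite subr0.
  by apply: (@cvg_comp _ _ _ dl h); last exact: hc.
exact: (cvg_unique _ cvgF hlim).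
Unshelve. all: by end_near.
Qed.

End ArcsineWeight.

(** * The Chebyshev measure of polynomials is a grid average *)

Section ChebyshevMeasure.
Context {R : realType}.
Implicit Types (k l : nat) (P Q : poly2 R).
Local Notation mu := (@lebesgue_measure R).
Local Notation mu2 := (@lebesgue_measure R \x @lebesgue_measure R)%E.
Local Notation w := arcsine_density.

(** Adding 1 to [T_k] makes the integrand nonnegative, so that monotone
    convergence and Tonelli's theorem apply; these products still span all
    polynomials. *)
Definition bump_density k : R -> R := (fun x => (1 + cheb x k) * w x / pi) \_ open_unit_itv.

Definition bump_mass k : R := if k == 0%N then 2 else 1.

Lemma cheb_acos (x : R) k : -1 <= x <= 1 -> cheb x k = cos (k%:R * acos x).
Proof. by move=> x1; rewrite -cheb_cos acosK. Qed.

Lemma bump_density_ge0 k x : 0 <= bump_density k x.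
Proof.
rewrite /bump_density patchE; case: ifP => //; rewrite inE /open_unit_itv /= in_itv /= => /andP[a b].
apply: divr_ge0; last exact: pi_ge0.
apply: mulr_ge0; last exact: arcsine_ge0.
by rewrite cheb_acos ?(ltW a) ?(ltW b)// -lerBlDl sub0r cos_geN1.
Qed.

Lemma continuous_cheb k : continuous (fun x : R => cheb x k).
Proof.
elim/cheb_ind: k => [||k IH1 IH2] x.
- exact: cvg_cst.
- exact: cvg_id.
- apply: cvgB; last exact: IH1.
  by apply: cvgM; [apply: cvgM; [exact: cvg_cst|exact: cvg_id]|exact: IH2].
Qed.

Lemma measurable_bump k : measurable_fun [set: R] (bump_density k).
Proof.
apply/(measurable_restrictT _ (measurable_itv _)).
apply: open_continuous_measurable_fun; first exact: interval_open.
move=> x; rewrite inE /= in_itv/= => x1.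
apply: cvgM; last exact: cvg_cst.
apply: cvgM; last exact: continuous_arcsine.
by apply: cvgD; [exact: cvg_cst|exact: continuous_cheb].
Qed.

Lemma integral_bump k : (\int[mu]_x (bump_density k x)%:E)%E = (bump_mass k)%:E.
Proof.
have p0 : (pi : R) != 0 by rewrite gt_eqF ?pi_gt0.
pose g (t : R) := (1 + cos (k%:R * t)) / pi.
pose h (t : R) := (t + (if k == 0%N then t else k%:R^-1 * sin (k%:R * t))) / pi.
transitivity (\int[mu]_(x in open_unit_itv) (g (acos x) * w x)%:E)%E.
  rewrite [RHS]integral_mkcond; apply: eq_integral => x _.
  rewrite /bump_density !patchE; case: ifP => //; rewrite inE /open_unit_itv /= in_itv /= => /andP[a b].
  by rewrite cheb_acos ?(ltW a) ?(ltW b)// /g mulrAC.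
have gc : continuous g.
  move=> t; apply: cvgM; last exact: cvg_cst.
  apply: cvgD; first exact: cvg_cst.
  apply: (@continuous_comp _ _ _ (fun t : R => k%:R * t) cos); last exact: continuous_cos.
  by apply: cvgM; [exact: cvg_cst|exact: cvg_id].
have g0 t : 0 <= g t by rewrite divr_ge0 ?pi_ge0// -lerBlDl sub0r cos_geN1.
have dh (t : R) : is_derive t 1 h (g t).
  rewrite /h /g.
  have -> : (fun t : R => (t + (if k == 0%N then t else k%:R^-1 * sin (k%:R * t))) / pi) =
     pi^-1 *: (id + (if k == 0%N then id else k%:R^-1 *: (sin \o (k%:R *: id)))).
    by apply/funext => s; rewrite /= mulrC; case: eqP.
  rewrite mulrC; apply: is_deriveZ; apply: is_deriveD.
  case: eqVneq => [->|k0]; first by rewrite mul0r cos0; exact: is_derive_id.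
  have -> : cos (k%:R * t) = k%:R^-1 *: (cos (k%:R * t) * (k%:R *: 1)).
    by rewrite /GRing.scale /= mulr1 mulrCA mulVf ?mulr1// pnatr_eq0.
  apply: is_deriveZ.
rewrite (@integral_arcsine _ g h gc g0 dh).
congr EFin; rewrite /h /bump_mass !mulr0 sin0 sin_natpi mulr0.
by case: eqP => _; move: p0; move: (pi : R) => q q0; field.
Qed.

Definition bump_poly k l : poly2 R :=
  (1 + cheb (Xvar ord0) k) * (1 + cheb (Xvar ord_max) l).

Lemma eval2_bump k l (x : R * R) :
  eval2 (bump_poly k l) x = (1 + cheb x.1 k) * (1 + cheb x.2 l).
Proof.
by rewrite /eval2 /bump_poly mevalM !mevalD !meval1 !(rmorph_cheb (meval _)) /= /Xvar !mevalXU.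
Qed.

Lemma bump_restrict k l : (fun x => (eval2 (bump_poly k l) x * cheb_weight x)) \_ square =
  (fun x : R * R => bump_density k x.1 * bump_density l x.2).
Proof.
apply/funext => -[x y]; rewrite /bump_density !patchE /=.
have w1 (z : R) : -1 <= z <= 1 -> (z \in open_unit_itv) = false -> w z = 0.
  move=> /andP[a b]; rewrite /open_unit_itv mem_setE in_itv/= => /negbT zI.
  have : z = -1 \/ z = 1.
    have [->|z1] := eqVneq z 1; first by right.
    left; apply/eqP; rewrite eq_le a andbT leNgt; apply/negP => z2.
    by rewrite z2 lt_neqAle z1 b in zI.
  by move=> [|] ->; rewrite /w ?sqrrN expr1n subrr sqrtr0 invr0.
have sE : ((x, y) \in (square : set (R * R))) = (-1 <= x <= 1) && (-1 <= y <= 1).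
  apply/idP/idP; rewrite /square inE /= !in_itv/=; first by move=> [-> ->].
  by move=> /andP[].
have sub z : (z \in (open_unit_itv : set R)) -> -1 <= z <= 1.
  by rewrite /open_unit_itv mem_setE in_itv/= => /andP[a b]; rewrite !ltW.
rewrite sE; case: ifPn => [/andP[x1 y1]|]; last first.
  rewrite negb_and => /orP[] h.
    have -> : (x \in (open_unit_itv : set R)) = false by apply/negbTE; apply: contra h; exact: sub.
    by rewrite mul0r.
  have -> : (y \in (open_unit_itv : set R)) = false by apply/negbTE; apply: contra h; exact: sub.
  by rewrite mulr0.
rewrite eval2_bump /cheb_weight /=.
case: ifPn => [xI|/negbTE/(w1 _ x1)]; last by rewrite /w => ->; rewrite !(mulr0, mul0r).
case: ifPn => [yI|/negbTE/(w1 _ y1)]; last by rewrite /w => ->; rewrite !(mulr0, mul0r).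
by rewrite /w -exprVn; ring.
Qed.

Lemma measurable_bump2 k l :
  measurable_fun [set: R * R] (fun x : R * R => bump_density k x.1 * bump_density l x.2).
Proof.
apply: measurable_funM.
  exact: (measurableT_comp (measurable_bump k) measurable_fst).
exact: (measurableT_comp (measurable_bump l) measurable_snd).
Qed.

Lemma measurable_square : measurable (square : set (measurableTypeR R * measurableTypeR R)).
Proof. by apply: measurableX; exact: measurable_itv. Qed.

Lemma integral_bump2 k l :
  (\int[mu2]_(x in square) (eval2 (bump_poly k l) x * cheb_weight x)%:E)%E
  = (bump_mass k * bump_mass l)%:E.
Proof.
rewrite integral_mkcond.
transitivity (\int[mu2]_x (bump_density k x.1 * bump_density l x.2)%:E)%E.
  apply: eq_integral => x _; have := congr1 (fun f => f x) (bump_restrict k l).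
  by rewrite !patchE => <-; case: ifP.
rewrite fubini_tonelli1 /fubini_F /=; last 2 first.
- by apply/measurable_EFinP; exact: measurable_bump2.
- by move=> x; rewrite lee_fin mulr_ge0 ?bump_density_ge0.
transitivity (\int[mu]_x ((bump_density k x)%:E * (bump_mass l)%:E))%E.
  apply: eq_integral => x _.
  under eq_integral do rewrite EFinM.
  rewrite ge0_integralZl ?integral_bump ?lee_fin ?bump_density_ge0//.
    by apply/measurable_EFinP; exact: measurable_bump.
  by move=> y _; rewrite lee_fin bump_density_ge0.
rewrite ge0_integralZr ?integral_bump//.
- by apply/measurable_EFinP; exact: measurable_bump.
- by move=> y _; rewrite lee_fin bump_density_ge0.
- by rewrite lee_fin /bump_mass; case: ifP.
Qed.

Definition grid_mean M Q : R :=
  ((M * M)%:R)^-1 * \sum_(b : 'I_M * 'I_M) eval2 Q (cos (@gridpt R M b).1, cos (gridpt b).2).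

Definition grid_exact M Q :=
  mu2.-integrable square (fun x => (eval2 Q x * cheb_weight x)%:E) /\
  (\int[mu2]_(x in square) (eval2 Q x * cheb_weight x)%:E)%E = (grid_mean M Q)%:E.

Lemma sum_cos_grid M k : (k < M)%N ->
  \sum_(a < M) cos (k%:R * (a%:R * (2 * pi / M%:R))) = if k == 0%N then M%:R else 0 :> R.
Proof.
move=> kM; have M0 : (0 < M)%N by apply: leq_ltn_trans kM.
have := congr1 (@complex.Re R) (@sum_cis R M k M0).
rewrite (raddf_sum (@complex.Re R)) /= dvdzE /=.
case: eqVneq => [->|k0].
  by rewrite dvdn0 -(rmorph_nat (real_complex R)).
by rewrite gtnNdvd ?lt0n.
Qed.

Lemma grid_mean_bump M k l : (k < M)%N -> (l < M)%N ->
  grid_mean M (bump_poly k l) = bump_mass k * bump_mass l.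
Proof.
move=> kM lM; have M0 : M%:R != 0 :> R by rewrite pnatr_eq0 -lt0n; lia.
have s1 j : (j < M)%N ->
    \sum_(a < M) (1 + cos (j%:R * (a%:R * (2 * pi / M%:R)))) = M%:R * bump_mass j.
  move=> jM; rewrite big_split sumr_const card_ord /= sum_cos_grid// /bump_mass.
  by case: ifP => _; ring.
rewrite /grid_mean (_ : \sum_b _ = M%:R * bump_mass k * (M%:R * bump_mass l)).
  by rewrite natrM; field.
rewrite -!s1// big_distrlr pair_bigA /=; apply: eq_bigr => -[a b] _.
by rewrite eval2_bump /= !cheb_cos.
Qed.

Lemma grid_exact_bump M k l : (k < M)%N -> (l < M)%N -> grid_exact M (bump_poly k l).
Proof.
move=> kM lM; split; last by rewrite integral_bump2 grid_mean_bump.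
apply/integrableP; split.
  apply/measurable_EFinP; apply/(measurable_restrictT _ measurable_square).
  by rewrite bump_restrict; exact: measurable_bump2.
rewrite (_ : (\int[_]_(x in _) _)%E = (\int[mu2]_(x in square) (eval2 (bump_poly k l) x * cheb_weight x)%:E)%E).
  by rewrite integral_bump2 ltry.
apply: eq_integral => x xs; rewrite gee0_abs// lee_fin.
have := congr1 (fun f => f x) (bump_restrict k l); rewrite patchE xs => ->.
by rewrite mulr_ge0 ?bump_density_ge0.
Qed.

Lemma grid_exact_lin M (c : R) P Q : grid_exact M P -> grid_exact M Q ->
  grid_exact M (c *: P + Q).
Proof.
move=> [iP vP] [iQ vQ].
have E : (fun x => (eval2 (c *: P + Q) x * cheb_weight x)%:E) =
    (fun x => c%:E * (eval2 P x * cheb_weight x)%:E + (eval2 Q x * cheb_weight x)%:E)%E.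
  by apply/funext => x; rewrite /eval2 mevalD mevalZ -EFinM -EFinD mulrDl -mulrA.
have icP := integrableZl measurable_square c iP.
split; rewrite E; first exact: (integrableD measurable_square icP iQ).
rewrite (integralD measurable_square icP iQ) (integralZl measurable_square iP) vP vQ.
rewrite -EFinM -EFinD; congr EFin; rewrite /grid_mean mulrCA -mulrDr; congr (_ * _).
rewrite mulr_sumr -big_split; apply: eq_bigr => b _ /=.
by rewrite /eval2 mevalD mevalZ.
Qed.

Lemma grid_exact_cheb2 M k l : (k < M)%N -> (l < M)%N -> grid_exact M (cheb2 k l).
Proof.
move=> kM lM; have M0 : (0 < M)%N by apply: leq_ltn_trans kM.
have -> : cheb2 k l = (- 2^-1 : R) *: bump_poly k 0 + ((- 2^-1 : R) *: bump_poly 0 l +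
    ((4^-1 : R) *: bump_poly 0 0 + bump_poly k l)).
  rewrite /bump_poly /cheb2 !cheb0.
  have half (p : poly2 R) : (2^-1 : R) *: (p * (1 + 1)) = p.
    have -> : p * (1 + 1) = (2 : R) *: p by rewrite scaler_nat mulrDr mulr1 mulr2n.
    by rewrite scalerA mulVf ?scale1r// pnatr_eq0.
  have -> : (4^-1 : R) = 2^-1 * 2^-1 by field.
  rewrite !scaleNr -scalerA half [(1 + 1) * (1 + _)]mulrC half.
  rewrite half -[1 + 1]mul1r half; ring.
by do 3!(apply: grid_exact_lin; first exact: grid_exact_bump); exact: grid_exact_bump.
Qed.

(** Both sides are linear in the polynomial and agree on products of Chebyshev
    polynomials of degree less than [M]. *)
Lemma grid_exact_Pi2 M N Q : Pi2 N Q -> (N < M)%N -> grid_exact M Q.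
Proof.
move=> /Pi2_cheb_span[d ->] NM; rewrite /cheb_sum.
apply: (big_ind (grid_exact M)).
- have M0 : (0 < M)%N by apply: leq_ltn_trans NM.
  have := grid_exact_lin (-1) (grid_exact_bump M0 M0) (grid_exact_bump M0 M0).
  by rewrite scaleN1r addNr.
- by move=> P P' h h'; have := grid_exact_lin 1 h h'; rewrite scale1r.
- move=> i _; have := triangle_le i => il.
  have h : grid_exact M (cheb2 (triangle_fst i) (triangle_snd i)) by apply: grid_exact_cheb2; lia.
  have := grid_exact_lin (d i - 1) h h.
  by rewrite scalerBl scale1r subrK.
Qed.

End ChebyshevMeasure.

(** * Weierstrass approximation on the square *)

Section Bernstein.
Context {A : comNzRingType}.

(** The Bernstein polynomial [sum_k C(n,k) x^k (1-x)^(n-k) g k], that is the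
    expectation of [g] under a binomial law; conditioning on the first trial
    gives a recursion that makes sense in any commutative ring. *)
Fixpoint bern (x : A) (n : nat) (g : nat -> A) : A :=
  if n is n'.+1 then (1 - x) * bern x n' g + x * bern x n' (g \o S) else g 0%N.

End Bernstein.

Lemma rmorph_bern (A B : comNzRingType) (f : {rmorphism A -> B}) x n g :
  f (bern x n g) = bern (f x) n (f \o g).
Proof.
elim: n g => [|n IH] g //=.
by rewrite rmorphD !rmorphM rmorphB rmorph1 !IH.
Qed.

Section BernsteinReal.
Context {R : realType}.
Implicit Types (x y : R) (g h : nat -> R).

Lemma bern_le x n g h : 0 <= x <= 1 -> (forall k, g k <= h k) -> bern x n g <= bern x n h.
Proof.
move=> /andP[x0 x1]; elim: n g h => [|n IH] g h gh //=.
by apply: lerD; apply: ler_wpM2l; rewrite ?subr_ge0//; apply: IH => k; exact: gh.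
Qed.

Lemma bern_lin x n (a b : R) g h :
  bern x n (fun k => a * g k + b * h k) = a * bern x n g + b * bern x n h.
Proof.
elim: n g h => [|n IH] g h //=.
rewrite IH (_ : _ \o S = (fun k => a * (g \o S) k + b * (h \o S) k))// IH; ring.
Qed.

Lemma bern_cst x n (a : R) : bern x n (fun=> a) = a.
Proof. by elim: n => [|n IH] //=; rewrite (_ : _ \o S = (fun=> a))// IH; ring. Qed.

Lemma bern_id x n : bern x n (fun k => k%:R) = n%:R * x.
Proof.
elim: n => [|n IH] /=; first by rewrite mul0r.
rewrite (_ : _ \o S = (fun k => 1 * k%:R + 1 * 1)); last first.
  by apply/funext => k /=; rewrite -natr1 !mul1r.
by rewrite (bern_lin _ _ 1 1 (fun k => k%:R) (fun=> 1)) IH bern_cst -natr1; ring.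
Qed.

Lemma bern_sqr x n : bern x n (fun k => k%:R ^+ 2) = n%:R * x * (1 - x) + n%:R ^+ 2 * x ^+ 2.
Proof.
elim: n => [|n IH] /=; first by rewrite !mul0r expr2 !mul0r addr0.
rewrite (_ : _ \o S = (fun k => 1 * k%:R ^+ 2 + 1 * (2 * k%:R + 1 * 1))); last first.
  by apply/funext => k /=; rewrite -natr1; ring.
rewrite (bern_lin _ _ 1 1 (fun k => k%:R ^+ 2) (fun k => 2 * k%:R + 1 * 1)).
by rewrite (bern_lin _ _ 2 1 (fun k => k%:R) (fun=> 1)) IH bern_id bern_cst -natr1; ring.
Qed.

Lemma bern_variance x n : 0 <= x <= 1 -> (0 < n)%N ->
  bern x n (fun k => (x - k%:R / n%:R) ^+ 2) <= n%:R^-1.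
Proof.
move=> /andP[x0 x1] n0; have nR : n%:R != 0 :> R by rewrite pnatr_eq0 -lt0n.
have -> : (fun k : nat => (x - k%:R / n%:R) ^+ 2) =
   (fun k => n%:R ^- 2 * k%:R ^+ 2 + 1 * ((- 2 * x / n%:R) * k%:R + x ^+ 2 * 1)).
  by apply/funext => k; field.
rewrite (bern_lin _ _ _ _ (fun k => k%:R ^+ 2) (fun k => (- 2 * x / n%:R) * k%:R + x ^+ 2 * 1)).
rewrite (bern_lin _ _ _ _ (fun k => k%:R) (fun=> 1)) bern_sqr bern_id bern_cst.
have -> : n%:R ^- 2 * (n%:R * x * (1 - x) + n%:R ^+ 2 * x ^+ 2) +
  1 * (- 2 * x / n%:R * (n%:R * x) + x ^+ 2 * 1) = n%:R^-1 * (x * (1 - x)) by field.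
rewrite ler_piMr ?invr_ge0//; nra.
Qed.

(** Korovkin's argument: the operator is positive, reproduces constants, and the
    quadratic majorant averages to at most [a + 2 c / n]. *)
Lemma bern2_approx (F : nat -> nat -> R) x y n (v a c : R) :
  0 <= x <= 1 -> 0 <= y <= 1 -> (0 < n)%N -> 0 <= c ->
  (forall j k, `|F j k - v| <= a + c * ((x - j%:R / n%:R) ^+ 2 + (y - k%:R / n%:R) ^+ 2)) ->
  `|bern x n (fun j => bern y n (F j)) - v| <= a + c * (2 / n%:R).
Proof.
move=> x01 y01 n0 c0 FE.
have E s : bern x n (fun j => bern y n (fun k => v + s * (a + c * ((x - j%:R / n%:R) ^+ 2 + (y - k%:R / n%:R) ^+ 2))))
  = v + s * (a + c * (bern x n (fun j => (x - j%:R / n%:R) ^+ 2) + bern y n (fun k => (y - k%:R / n%:R) ^+ 2))).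
  transitivity (bern x n (fun j => (s * c) * (x - j%:R / n%:R) ^+ 2 +
     1 * (v + s * a + s * c * bern y n (fun k => (y - k%:R / n%:R) ^+ 2)))).
    congr bern; apply/funext => j.
    rewrite (_ : (fun k => _) = (fun k => s * c * (y - k%:R / n%:R) ^+ 2 + 1 * (v + s * (a + c * (x - j%:R / n%:R) ^+ 2)))).
      by rewrite (bern_lin _ _ _ _ (fun k => (y - k%:R / n%:R) ^+ 2) (fun=> _)) bern_cst; ring.
    by apply/funext => k; ring.
  by rewrite (bern_lin _ _ _ _ (fun j => (x - j%:R / n%:R) ^+ 2) (fun=> _)) bern_cst; ring.
have V : bern x n (fun j => (x - j%:R / n%:R) ^+ 2) + bern y n (fun k => (y - k%:R / n%:R) ^+ 2) <= 2 / n%:R.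
  by rewrite mulr_natl mulr2n lerD// bern_variance.
have cV := ler_wpM2l c0 V.
have up : bern x n (fun j => bern y n (F j)) <= v + 1 * (a + c * (2 / n%:R)).
  apply: (@le_trans _ _ (v + 1 * (a + c * (bern x n (fun j => (x - j%:R / n%:R) ^+ 2) + bern y n (fun k => (y - k%:R / n%:R) ^+ 2))))).
    rewrite -E; apply: bern_le => // j; apply: bern_le => // k.
    by have := FE j k; rewrite ler_norml => /andP[_]; lra.
  by rewrite !mul1r !lerD2l.
have lo : v + (-1) * (a + c * (2 / n%:R)) <= bern x n (fun j => bern y n (F j)).
  apply: (@le_trans _ _ (v + (-1) * (a + c * (bern x n (fun j => (x - j%:R / n%:R) ^+ 2) + bern y n (fun k => (y - k%:R / n%:R) ^+ 2))))).
    by rewrite lerD2l !mulN1r lerN2 lerD2l.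
  rewrite -E; apply: bern_le => // j; apply: bern_le => // k.
  by have := FE j k; rewrite ler_norml => /andP[+ _]; lra.
by rewrite ler_norml; apply/andP; split; lra.
Qed.

End BernsteinReal.

Section Weierstrass.
Context {R : realType}.
Implicit Types (f : R * R -> R) (n : nat).

Lemma compact_square : compact (square : set (R * R)).
Proof. by apply: compact_setX; exact: segment_compact. Qed.

Lemma square_bounded f : {within square, continuous f} ->
  exists2 B : R, 0 < B & forall x, square x -> `|f x| <= B.
Proof.
move=> cf; have /compact_bounded := continuous_compact cf compact_square.
move=> [B [Br BP]]; exists (Num.max B 0 + 1).
  by rewrite ltr_pwDr// le_max lexx orbT.
move=> x xs; apply: (BP (Num.max B 0 + 1)); last by exists x.
by rewrite ltr_pwDr// le_max lexx.
Qed.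

(** Heine-Cantor, from the near-covering form of compactness with the modulus
    [dl] as the parameter that tends to zero. *)
Lemma square_unif_continuous f (e : R) : {within square, continuous f} -> 0 < e ->
  exists2 dl : R, 0 < dl & forall x y, square x -> square y ->
    `|x.1 - y.1| < dl -> `|x.2 - y.2| < dl -> `|f x - f y| <= e.
Proof.
move=> /subspace_continuousP cf e0.
have /compact_near_coveringP := compact_square.
move=> /(_ R (0 : R)^'+ (fun dl x => square x -> forall y, square y ->
    `|x.1 - y.1| < dl -> `|x.2 - y.2| < dl -> `|f x - f y| <= e) _).
have e2 : 0 < e / 2 by rewrite divr_gt0.
case.
  move=> x xs; have := cf x xs => /cvgrPdist_le /(_ _ e2).
  rewrite near_withinE => /nbhs_ballP[r /= r0 rP].
  have r2 : 0 < r / 2 by rewrite divr_gt0.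
  exists (ball x (r / 2), [set dl | dl < r / 2]) => /=.
    split; first exact: nbhsx_ballx.
    exact: nbhs_right_lt.
  move=> [x' dl] /= [[b1 b2] dlr] x's y ys d1 d2.
  have h1 : `|f x - f x'| <= e / 2.
    apply: rP => //; split; [apply: lt_trans b1 _|apply: lt_trans b2 _]; lra.
  have h2 : `|f x - f y| <= e / 2.
    apply: rP => //; move: b1 b2; rewrite /ball /= => b1 b2; split; rewrite /ball/=.
      rewrite (_ : x.1 - y.1 = (x.1 - x'.1) + (x'.1 - y.1)); last by ring.
      apply: le_lt_trans (ler_normD _ _) _; lra.
    rewrite (_ : x.2 - y.2 = (x.2 - x'.2) + (x'.2 - y.2)); last by ring.
    apply: le_lt_trans (ler_normD _ _) _; lra.
  rewrite (_ : f x' - f y = (f x - f y) - (f x - f x')); last by ring.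
  apply: le_trans (ler_normB _ _) _; lra.
move=> r /= r0 rP; exists (r / 2); first by rewrite divr_gt0.
move=> x y xs ys; apply: (rP (r / 2)) => //=; last by rewrite divr_gt0.
by rewrite sub0r normrN gtr0_norm ?divr_gt0//; lra.
Qed.

(** Uniform continuity and boundedness give the quadratic majorant needed for
    [bern2_approx]; the sample points are clipped to the square. *)
Lemma weierstrass_square f (e : R) : {within square, continuous f} -> 0 < e ->
  exists P : poly2 R, forall x, square x -> `|f x - eval2 P x| <= e.
Proof.
move=> cf e0; have [B B0 fB] := square_bounded cf.
have e2 : 0 < e / 2 by rewrite divr_gt0.
have [dl dl0 fdl] := square_unif_continuous cf e2.
pose c := 8 * B / dl ^+ 2; have c0 : 0 < c by rewrite divr_gt0 ?mulr_gt0 ?exprn_gt0.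
have [n n0 nc] : exists2 n, (0 < n)%N & c * (2 / n%:R) <= e / 2.
  exists (Num.bound (4 * c / e)).+1 => //.
  rewrite mulrA ler_pdivrMr ?ltr0n//.
  have h : 0 <= 4 * c / e by apply/ltW/divr_gt0 => //; exact: mulr_gt0.
  have := archi_boundP h.
  rewrite ltr_pdivrMr// -[(Num.bound _).+1%:R]natr1; set N := (Num.bound _)%:R; nra.
pose z (j : nat) : R := 2 * (Num.min (j%:R / n%:R) 1) - 1.
pose half (i : 'I_2) : poly2 R := (2^-1 : R) *: (mpolyX R (mnm1 i) + 1).
pose P : poly2 R := bern (half ord0) n
   (fun j => bern (half ord_max) n (fun k => mpolyC 2 (f (z j, z k)))).
have evP x : eval2 P x = bern ((x.1 + 1) / 2) n
   (fun j => bern ((x.2 + 1) / 2) n (fun k => f (z j, z k))).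
  have hE i : meval (fun i : 'I_2 => if i == ord0 then x.1 else x.2) (half i) =
      ((if i == ord0 then x.1 else x.2) + 1) / 2.
    by rewrite mevalZ mevalD meval1 mevalXU mulrC.
  rewrite /eval2 /P (rmorph_bern (meval _)) /= hE; congr bern; apply/funext => j.
  rewrite /= (rmorph_bern (meval _)) /= hE; congr bern; apply/funext => k.
  by rewrite /= mevalC.
exists P => x xs; rewrite evP distrC.
have [x1 x2] : (-1 <= x.1 <= 1) /\ (-1 <= x.2 <= 1).
  by move: xs; rewrite /square /= !in_itv /= => -[].
set u := (x.1 + 1) / 2; set v := (x.2 + 1) / 2.
have u01 : 0 <= u <= 1 by rewrite /u; lra.
have v01 : 0 <= v <= 1 by rewrite /v; lra.
rewrite [e]splitr; apply: (@le_trans _ _ (e / 2 + c * (2 / n%:R))); last by rewrite lerD2l.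
apply: bern2_approx => //; first exact: ltW.
move=> j k; rewrite distrC.
have q0 i : 0 <= i%:R / n%:R :> R by rewrite divr_ge0.
have z1 i : -1 <= z i <= 1.
  by rewrite /z; have := q0 i; case: (leP (i%:R / n%:R) 1) => h1 h2; lra.
have zs : square (z j, z k) by rewrite /square /= !in_itv/= !z1.
have zd (t : R) i : 0 <= t <= 1 -> (2 * t - 1 - z i) ^+ 2 <= 4 * (t - i%:R / n%:R) ^+ 2.
  by move=> t01; rewrite /z; case: (leP (i%:R / n%:R) 1) => h1; nra.
have ex1 : x.1 = 2 * u - 1 by rewrite /u; field.
have ex2 : x.2 = 2 * v - 1 by rewrite /v; field.
have [c1|c1] := ltP `|x.1 - z j| dl; last first.
  have h : dl ^+ 2 <= 4 * (u - j%:R / n%:R) ^+ 2.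
    apply: le_trans (zd _ _ u01); rewrite -ex1 -[leRHS]real_normK ?num_real//.
    by apply: lerXn2r; [rewrite nnegrE; exact: (ltW dl0)|rewrite nnegrE; exact: normr_ge0|exact: c1].
  apply: (@le_trans _ _ (2 * B)).
    apply: le_trans (ler_normB _ _) _; rewrite mulr_natl mulr2n.
    by rewrite lerD// fB.
  have h' : 2 * B <= c * (u - j%:R / n%:R) ^+ 2.
    rewrite /c mulrAC ler_pdivlMr ?exprn_gt0//; nra.
  have : 0 <= c * (v - k%:R / n%:R) ^+ 2 by rewrite mulr_ge0 ?sqr_ge0 ?ltW.
  lra.
have [c2|c2] := ltP `|x.2 - z k| dl; last first.
  have h : dl ^+ 2 <= 4 * (v - k%:R / n%:R) ^+ 2.
    apply: le_trans (zd _ _ v01); rewrite -ex2 -[leRHS]real_normK ?num_real//.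
    by apply: lerXn2r; [rewrite nnegrE; exact: (ltW dl0)|rewrite nnegrE; exact: normr_ge0|exact: c2].
  apply: (@le_trans _ _ (2 * B)).
    apply: le_trans (ler_normB _ _) _; rewrite mulr_natl mulr2n.
    by rewrite lerD// fB.
  have h' : 2 * B <= c * (v - k%:R / n%:R) ^+ 2.
    rewrite /c mulrAC ler_pdivlMr ?exprn_gt0//; nra.
  have : 0 <= c * (u - j%:R / n%:R) ^+ 2 by rewrite mulr_ge0 ?sqr_ge0 ?ltW.
  lra.
have := fdl x (z j, z k) xs zs c1 c2; move=> /le_trans; apply.
by rewrite lerDl mulr_ge0 ?addr_ge0 ?sqr_ge0 ?ltW.
Qed.

End Weierstrass.

(** * The error estimate *)

(** The integral of a nonnegative function is a supremum over simple functions
    below it, hence monotone even for functions that are not measurable; this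
    spares the measurability of the interpolation error. *)
Lemma le_integral_of_ge0 d (T : measurableType d) (R : realType)
    (mu : {measure set T -> \bar R}) (D : set T) (f g : T -> \bar R) :
  (forall x, D x -> (0 <= f x)%E) -> (forall x, D x -> (f x <= g x)%E) ->
  (\int[mu]_(x in D) f x <= \int[mu]_(x in D) g x)%E.
Proof.
move=> f0 fg; have g0 x : D x -> (0 <= g x)%E by move=> Dx; exact: le_trans (f0 _ Dx) (fg _ Dx).
rewrite !ge0_integralE//; apply: ereal_sup_le => _ [h hf <-]; exists h => // x.
apply: le_trans (hf x) _; rewrite !patchE; case: ifPn => // xD.
by apply: fg; rewrite inE in xD.
Qed.

Section PaduaBound.
Context {R : realType}.
Implicit Types (f : R * R -> R) (n m : nat) (P Q : poly2 R).
Local Notation mu2 := (@lebesgue_measure R \x @lebesgue_measure R)%E.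

Lemma Pad_square n (x : R * R) : Pad n x -> square x.
Proof.
move=> [k [j [_ _ ->]]]; rewrite /square /= !in_itv /= /pad_xi /pad_eta.
rewrite cos_geN1 cos_le1; case: ifP => _; by rewrite cos_geN1 cos_le1.
Qed.

Lemma Pi2_exp n P k : Pi2 n P -> Pi2 (n * k) (P ^+ k).
Proof.
move=> nP; elim: k => [|k IH]; first by rewrite muln0 /Pi2/= msize1.
by rewrite exprS mulnS; exact: Pi2_mul.
Qed.

Lemma padua_const_ge0 m : 0 <= @padua_const R m.
Proof.
have : 0 <= @sampling_const R m.
  by rewrite /sampling_const mulr_ge0 ?exprn_ge0 ?riesz_const_ge0 ?divr_ge0.
by rewrite lecE => /andP[].
Qed.

Lemma cheb_weight_ge0 (x : R * R) : 0 <= cheb_weight x.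
Proof. by rewrite /cheb_weight !mulr_ge0// invr_ge0 ?sqrtr_ge0// exprn_ge0// pi_ge0. Qed.

Lemma padua_sampling n m M P (E : R) : (0 < n)%N -> (0 < m)%N ->
  ((2 * n.+1) * m + (2 * n.+1) * m < M)%N -> Pi2 n P ->
  (forall x, Pad n x -> `|eval2 P x| <= E) ->
  grid_mean M (P ^+ (m + m)) <= padua_const m * E ^+ (m + m).
Proof.
move=> n0 m0 nM /Pi2_cheb_span[d ->] PE.
have M0 : 0 < (M * M)%:R :> R by rewrite ltr0n muln_gt0; lia.
rewrite /grid_mean mulrC ler_pdivrMr//.
apply: le_trans (padua_grid_le n0 m0 nM (fun t => PE _ (padua_node_Pad t n0))).
by rewrite le_eqVlt; apply/orP; left; apply/eqP/eq_bigr => b _; rewrite /eval2 rmorphXn.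
Qed.

Definition Lp_const m : R := 1 + 2 ^+ (m + m) * (1 + padua_const m).

(** Reduces the exponent [p] to an even integer exponent. *)
Lemma powR_le_even (p s : R) m : 0 < p -> p <= (m + m)%:R -> 0 <= s ->
  (s + 1) `^ p <= 2 ^+ (m + m) * (1 + s ^+ (m + m)).
Proof.
move=> p0 pm s0; have s1 : 1 <= s + 1 by rewrite lerDr.
apply: le_trans (ler_powR s1 pm) _; rewrite powR_mulrn ?addr_ge0//.
have S0 : 0 <= s ^+ (m + m) by rewrite exprn_ge0.
have [h|h] := leP s 1.
  apply: (@le_trans _ _ (2 ^+ (m + m))).
    by apply: lerXn2r; rewrite ?nnegrE ?addr_ge0//; lra.
  by rewrite ler_peMr ?exprn_ge0// lerDl.
apply: (@le_trans _ _ ((2 * s) ^+ (m + m))).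
  by apply: lerXn2r; rewrite ?nnegrE ?addr_ge0 ?mulr_ge0//; lra.
by rewrite exprMn ler_wpM2l ?exprn_ge0// lerDr.
Qed.

(** With [D] the difference of the interpolant and [P], [|L - f| <= |D| + E] on
    the square, so [|L - f|^p] is at most the polynomial [Q], whose Chebyshev
    integral is a grid mean controlled by the sampling inequality. *)
Lemma wnorm_padua_le (p : R) m n f P (E : R) : 0 < p -> (0 < m)%N -> p <= (m + m)%:R ->
  (0 < n)%N -> Pi2 n P -> 0 < E -> (forall x, square x -> `|f x - eval2 P x| <= E) ->
  (wnorm p (fun x => eval2 (padua_interp n f) x - f x)%R <= (Lp_const m `^ p^-1 * E)%:E)%E.
Proof.
move=> p0 m0 pm n0 nP E0 fP.
have [nL LI] := padua_interpP f n0.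
set L := padua_interp n f in nL LI *.
pose D := L - P.
have nD : Pi2 n D by rewrite /D -scaleN1r; apply: Pi2D => //; exact: Pi2Z.
have DE x : eval2 D x = eval2 L x - eval2 P x by rewrite /eval2 mevalB.
(* Fine enough for the sampling inequality and for exactness on [Q]. *)
pose M := (((2 * n.+1) * m + (2 * n.+1) * m).+1 + n * (m + m))%N.
have nM : ((2 * n.+1) * m + (2 * n.+1) * m < M)%N by rewrite /M; lia.
have DM : grid_mean M (D ^+ (m + m)) <= padua_const m * E ^+ (m + m).
  apply: (padua_sampling n0 m0 nM nD) => x xP.
  by rewrite DE LI//; apply: fP; exact: Pad_square xP.
pose b := 2 ^+ (m + m) * E `^ p / E ^+ (m + m).
have Em0 : 0 < E ^+ (m + m) by rewrite exprn_gt0.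
have Ep0 : 0 <= E `^ p by exact: powR_ge0.
pose Q : poly2 R := b *: D ^+ (m + m) + (2 ^+ (m + m) * E `^ p) *: 1.
have nQ : Pi2 (n * (m + m)) Q.
  apply: Pi2D; apply: Pi2Z; first exact: Pi2_exp.
  by rewrite /Pi2 /= msize1.
have MQ : (n * (m + m) < M)%N by rewrite /M; lia.
have [_ vQ] := grid_exact_Pi2 nQ MQ.
have QE x : eval2 Q x = b * eval2 D x ^+ (m + m) + 2 ^+ (m + m) * E `^ p.
  by rewrite /eval2 /Q mevalD !mevalZ meval1 mulr1 rmorphXn.
have gQ : grid_mean M Q <= Lp_const m * E `^ p.
  have M0 : (M * M)%:R != 0 :> R by rewrite pnatr_eq0 muln_eq0; lia.
  have -> : grid_mean M Q = b * grid_mean M (D ^+ (m + m)) + 2 ^+ (m + m) * E `^ p.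
    rewrite /grid_mean; under eq_bigr do rewrite QE.
    rewrite big_split /= -mulr_sumr mulrDr sumr_const card_prod !card_ord.
    rewrite -[_ * E `^ p *+ (M * M)]mulr_natl mulKf//; congr (_ + _).
    by rewrite mulrCA; congr (_ * (_ * _)); apply: eq_bigr => a _; rewrite /eval2 rmorphXn.
  have b0 : 0 <= b by rewrite /b divr_ge0 ?mulr_ge0 ?exprn_ge0// ltW.
  have := ler_wpM2l b0 DM.
  have -> : b * (padua_const m * E ^+ (m + m)) = 2 ^+ (m + m) * E `^ p * padua_const m.
    by rewrite /b; field; rewrite gt_eqF.
  rewrite /Lp_const => h; apply: (le_trans (lerD h (lexx _))).
  rewrite -subr_ge0 (_ : _ - _ = E `^ p) //; ring.
have intle : (\int[mu2]_(x in square) (`|eval2 L x - f x| `^ p * cheb_weight x)%:E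
     <= (Lp_const m * E `^ p)%:E)%E.
  apply: (@le_trans _ _ (\int[mu2]_(x in square) (eval2 Q x * cheb_weight x)%:E)%E); last first.
    by rewrite vQ lee_fin.
  apply: le_integral_of_ge0 => x xs; rewrite lee_fin.
    by rewrite mulr_ge0 ?powR_ge0 ?cheb_weight_ge0.
  rewrite ler_wpM2r ?cheb_weight_ge0// QE.
  set s := `|eval2 D x| / E; have s0 : 0 <= s by rewrite divr_ge0// ltW.
  apply: (@le_trans _ _ ((E * (s + 1)) `^ p)).
    apply: ge0_ler_powR; rewrite ?nnegrE ?mulr_ge0 ?addr_ge0 ?(ltW E0) ?(ltW p0)//.
    rewrite (_ : eval2 L x - f x = eval2 D x - (f x - eval2 P x)); last by rewrite DE; ring.
    apply: le_trans (ler_normB _ _) _; rewrite mulrDr mulr1 /s mulrC divfK ?gt_eqF//.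
    by rewrite lerD2l fP.
  rewrite powRM ?addr_ge0 ?(ltW E0)//.
  apply: (le_trans (ler_wpM2l Ep0 (powR_le_even p0 pm s0))).
  have -> : eval2 D x ^+ (m + m) = (s * E) ^+ (m + m).
    rewrite /s divfK ?gt_eqF// -normrX ger0_norm//.
    by rewrite exprn_even_ge0// addnn odd_double.
  rewrite [(s * E) ^+ _]exprMn /b.
  by rewrite le_eqVlt; apply/orP; left; apply/eqP; field; rewrite gt_eqF.
rewrite /wnorm -/L; move: intle.
have : (0 <= \int[mu2]_(x in square) (`|eval2 L x - f x| `^ p * cheb_weight x)%:E)%E.
  by apply: integral_ge0 => x _; rewrite lee_fin mulr_ge0 ?powR_ge0 ?cheb_weight_ge0.
have L0 : 0 <= Lp_const m.
  by rewrite /Lp_const addr_ge0// mulr_ge0 ?exprn_ge0// addr_ge0 ?padua_const_ge0.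
case: (\int[mu2]_(x in square) _)%E => [r| |] //; rewrite !lee_fin => r0 rle.
rewrite ?poweR_EFin ?lee_fin; apply: (@le_trans _ _ ((Lp_const m * E `^ p) `^ p^-1)).
  by apply: ge0_ler_powR; rewrite ?nnegrE ?invr_ge0 ?mulr_ge0// ltW.
rewrite powRM//; apply: ler_wpM2l; first exact: powR_ge0.
by rewrite -powRrM mulfV ?gt_eqF// powRr1// ltW.
Qed.

Lemma eval2_square_bounded P : exists2 B : R, 0 <= B &
  forall x, square x -> `|eval2 P x| <= B.
Proof.
have [d ->] := Pi2_cheb_span (leqnSn _ : Pi2 (msize P) P).
exists (\sum_i `|d i|) => [|x xs]; first by rewrite sumr_ge0.
have [x1 x2] : (-1 <= x.1 <= 1) /\ (-1 <= x.2 <= 1).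
  by move: xs; rewrite /square /= !in_itv /= => -[].
have -> : x = (cos (acos x.1, acos x.2).1, cos (acos x.1, acos x.2).2).
  by rewrite !acosK//; case: x {xs x1 x2}.
rewrite eval2_cheb_sum; apply: le_trans (ler_norm_sum _ _ _) _.
apply: ler_sum => i _; rewrite !normrM -[leRHS]mulr1 ler_wpM2l//.
by apply: mulr_ile1 => //; rewrite ler_norml cos_geN1 cos_le1.
Qed.

Definition sup_error f P : R := sup [set `|f x - eval2 P x| | x in square].

Lemma square0 : square ((0, 0) : R * R).
Proof. by rewrite /square /= !in_itv /=; split; apply/andP; split; lra. Qed.

Lemma sup_error_ub f P : {within square, continuous f} ->
  forall x, square x -> `|f x - eval2 P x| <= sup_error f P.
Proof.
move=> cf x xs; have [B B0 fB] := square_bounded cf.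
have [B' B'0 PB'] := eval2_square_bounded P.
apply: ub_le_sup; last by exists x.
exists (B + B') => _ [y ys <-].
by apply: le_trans (ler_normB _ _) _; rewrite lerD ?fB ?PB'.
Qed.

Lemma sup_error_ge0 f P : {within square, continuous f} -> 0 <= sup_error f P.
Proof. by move=> cf; apply: le_trans (sup_error_ub P cf square0). Qed.

Lemma sup_error_le f P (e : R) :
  (forall x, square x -> `|f x - eval2 P x| <= e) -> sup_error f P <= e.
Proof.
move=> fe; apply: ge_sup; first by exists `|f (0, 0) - eval2 P (0, 0)|, (0, 0) => //; exact: square0.
by move=> _ [x xs <-]; exact: fe.
Qed.

Lemma Pi20 n : Pi2 n (0 : poly2 R).
Proof. by rewrite /Pi2 /= msize0. Qed.

Lemma best_error_ge0 n f : {within square, continuous f} -> 0 <= best_error n f.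
Proof.
move=> cf; apply: lb_le_inf; first by exists (sup_error f 0), 0 => //; exact: Pi20.
by move=> _ [P _ <-]; exact: sup_error_ge0.
Qed.

Lemma best_error_le n f P : {within square, continuous f} -> Pi2 n P ->
  best_error n f <= sup_error f P.
Proof.
move=> cf nP; apply: ge_inf; last by exists P.
by exists 0 => _ [Q _ <-]; exact: sup_error_ge0.
Qed.

Lemma best_error_cvg0 f : {within square, continuous f} ->
  (fun n => best_error n f) @ \oo --> (0 : R).
Proof.
move=> cf; apply/cvgrPdist_le => e e0.
have [P fP] := weierstrass_square cf e0.
near=> n; rewrite sub0r normrN ger0_norm ?best_error_ge0//.
apply: le_trans (sup_error_le fP); apply: best_error_le => //.
apply: Pi2_le (_ : Pi2 (msize P) P); last exact: leqnSn.
near: n; exact: nbhs_infty_ge.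
Unshelve. all: by end_near.
Qed.

Lemma padua_error (p : R) : 0 < p -> exists2 c : R, 0 < c & forall n f,
  (1 <= n)%N -> {within square, continuous f} ->
  (wnorm p (fun x => eval2 (padua_interp n f) x - f x)%R <= (c * best_error n f)%:E)%E.
Proof.
move=> p0; pose m := (Num.bound p).+1.
have pm : p <= (m + m)%:R.
  apply: (le_trans (ltW (archi_boundP (ltW p0)))).
  by rewrite ler_nat /m; lia.
have L0 : 0 < Lp_const m.
  rewrite /Lp_const ltr_pwDl// mulr_ge0 ?exprn_ge0// addr_ge0 ?padua_const_ge0//.
pose c := Lp_const m `^ p^-1; have c0 : 0 < c by exact: powR_gt0.
exists c => // n f n1 cf.
have W P (e : R) : Pi2 n P -> 0 < e ->
    (wnorm p (fun x => eval2 (padua_interp n f) x - f x)%R <= (c * (sup_error f P + e))%:E)%E.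
  move=> nP e0; apply: (wnorm_padua_le p0 _ pm n1 nP) => //.
    by rewrite ltr_wpDl// sup_error_ge0.
  by move=> x xs; apply: le_trans (sup_error_ub P cf xs) _; rewrite lerDl ltW.
have : (0 <= wnorm p (fun x => eval2 (padua_interp n f) x - f x)%R)%E by exact: poweR_ge0.
move: W; case: (wnorm _ _) => [r| |] // W; last first.
  by have := W 0 1 (Pi20 n) ltr01; rewrite leye_eq.
rewrite !lee_fin => r0; rewrite mulrC -ler_pdivrMr//.
apply: lb_le_inf; first by exists (sup_error f 0), 0 => //; exact: Pi20.
move=> _ [P nP <-]; apply/ler_addgt0Pr => e e0.
by rewrite ler_pdivrMr// mulrC -lee_fin; exact: W.
Qed.

End PaduaBound.

Theorem theorem4p1 (R : realType) (p : R) (hp : 0 < p) :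
  (forall f : R * R -> R, {within square, continuous f} ->
     (fun n : nat => wnorm p (fun x => eval2 (padua_interp n f) x - f x))
       @ \oo --> 0%E)
  /\
  (exists c : R, forall (n : nat) (f : R * R -> R),
     (1 <= n)%N -> {within square, continuous f} ->
     (wnorm p (fun x => eval2 (padua_interp n f) x - f x)%R
        <= (c * best_error n f)%:E)%E).
Proof.
have [c c0 cP] := padua_error hp; split; last by exists c.
move=> f cf.
apply: (@squeeze_cvge _ _ _ _ (fun=> 0%E) _ (fun n => (c * best_error n f)%:E)).
- near=> n; rewrite poweR_ge0 /= cP//.
  by near: n; exact: nbhs_infty_ge.
- exact: cvg_cst.
- apply: cvg_EFin; first by near=> n.
  rewrite -[X in _ --> X](mulr0 c).
  by apply: cvgM; [exact: cvg_cst|exact: best_error_cvg0].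
Unshelve. all: by end_near.
Qed.
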